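(* Let $M_1 \overset{f_1}{\twoheadrightarrow} M_2 \overset{f_2}{\twoheadrightarrow} \dots \overset{f_{l}}{\twoheadrightarrow} M_{l+1}$ be a flag matroid of length $l$ on a finite ground set $E$, and let $K$ be an infinite field. The following statements are equivalent: (1) the flag matroid is realizable over $K$; (2) the Higgs factorization of the flag matroid is realizable over $K$; (3) the Higgs major of the flag matroid is realizable over $K$.
   Context: All matroids have finite ground sets; $\operatorname{rk}$ denotes rank. Quotients and flag matroids. If $M_1, M_2$ are matroids on the same ground set $E$, then $M_2$ is a quotient of $M_1$, written $f: M_1 \twoheadrightarrow M_2$, if every flat of $M_2$ is a flat of $M_1$. The nullity of $f$ is $\operatorname{rk}(M_1)-\operatorname{rk}(M_2)$; quotients of nullity one are called elementary. The nullity of $A\subseteq E$ is $n(A)=\operatorname{rk}_{M_1}(A)-\operatorname{rk}_{M_2}(A)$. A flag matroid of length $l$ is a chain of quotients $M_1 \twoheadrightarrow M_2 \twoheadrightarrow\dots\twoheadrightarrow M_{l+1}$ of matroids on $E$. Factorizations. A factorization of a quotient $f:M_1\twoheadrightarrow M_2$ of nullity $k$ is a sequence $N=(N_0,\dots,N_k)$ of matroids on $E$ with $N_0=M_1$, $N_k=M_2$ and each $N_{i-1}\twoheadrightarrow N_i$ an elementary quotient. For $0\le i\le k$ the $i$-th Higgs lift $L^i(f)$ is the matroid on $E$ whose flats are the flats of $M_2$ together with the flats of $M_1$ of nullity strictly less than $i$; the sequence $(L^k(f),\dots,L^0(f))$ is a factorization of $f$, called the Higgs factorization of $f$. The Higgs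 factorization of a flag matroid $M_1\twoheadrightarrow\dots\twoheadrightarrow M_{l+1}$ is the chain of elementary quotients obtained by replacing each quotient $f_i$ by its Higgs factorization and concatenating; it is a factorization of the quotient $M_1\twoheadrightarrow M_{l+1}$ (not necessarily its Higgs factorization). Modular cuts. A modular cut of a matroid $M$ is a nonempty family $\mathcal M$ of flats of $M$, upward closed among flats, such that if $A,B\in\mathcal M$ and $\operatorname{rk}(A)+\operatorname{rk}(B)=\operatorname{rk}(A\cap B)+\operatorname{rk}(A\cup B)$ then $A\cap B\in\mathcal M$. For $e$ not in the ground set of $M$, $M+_{\mathcal M}e$ denotes the one-element extension of $M$ (so $(M+_{\mathcal M}e)\setminus e=M$) for which the flats $F$ of $M$ that are not flats of $M+_{\mathcal M}e$ but such that $F\cup\{e\}$ is a flat of $M+_{\mathcal M}e$ are exactly the members of $\mathcal M$. For each elementary quotient $N\twoheadrightarrow N'$ there is a unique modular cut $\mathcal M$ of $N$ with $(N+_{\mathcal M}e)/e=N'$. If $\mathcal M$ is a modular cut of $M/e$, then $\mathcal M\cup e:=\{F\cup\{e\}:F\in\mathcal M\}$ is a modular cut of $M$, and $(M/e)+_{\mathcal M}f=(M+_{\mathcal M\cup e}f)/e$. Major of a factorization. Let $N=(N_0,\dots,N_k)$ be a factorization, let $e_1,\dots,e_k$ be distinct elements not in $E$, and let $\mathcal M_i$ be the modular cut of $N_{i-1}$ with $(N_{i-1}+_{\mathcal M_i}e_i)/e_i=N_i$. The matroid $\mathfrak M(N)$ on $E\cup\{e_1,\dots,e_k\}$ is obtained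 from $N_0$ by extending successively by $e_1,e_2,\dots,e_k$ with respect to the modular cuts $\mathcal M_1,\ \mathcal M_2\cup e_1,\ \mathcal M_3\cup e_1\cup e_2,\ \dots,\ \mathcal M_k\cup e_1\cup\dots\cup e_{k-1}$. The Higgs major of a flag matroid is $\mathfrak M(N)$, where $N$ is the Higgs factorization of the flag matroid. Realizability. A map $\varphi:E\to V$ into a $K$-vector space $V$ realizes a matroid $M$ on $E$ if $\dim V=\operatorname{rk}(M)$ and a subset $A\subseteq E$ is independent in $M$ if and only if the family $(\varphi(a))_{a\in A}$ is linearly independent; $M$ is realizable over $K$ if such a map exists. A chain of quotients $N_0\twoheadrightarrow N_1\twoheadrightarrow\dots\twoheadrightarrow N_m$ on $E$ (in particular a flag matroid or a factorization) is realizable over $K$ if there are maps $\varphi_i:E\to V_i$ realizing $N_i$ over $K$ for all $i$ and linear maps $g_i:V_{i-1}\to V_i$ with $\varphi_i=g_i\circ\varphi_{i-1}$ for $1\le i\le m$. *)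

(* Defs.v *)
From HB Require Import structures.
From mathcomp Require Import all_boot all_order all_algebra.

Set Implicit Arguments.
Unset Strict Implicit.
Unset Printing Implicit Defensive.

(* A matroid is given by its independent sets. Its ground set is a subset of
   an ambient finite type U, so that deletions, contractions and one-element
   extensions of a matroid all live in the same type. *)

Definition is_matroid (U : finType) (E : {set U}) (I : {set {set U}}) : bool :=
  [&& set0 \in I,
      [forall A in I, A \subset E],
      [forall A in I, forall B : {set U}, (B \subset A) ==> (B \in I)] &
      [forall A in I, forall B in I,
         (#|A| < #|B|) ==> [exists x in B :\: A, x |: A \in I]]].

Record matroid (U : finType) := Matroid {
  matroid_val : {set U} * {set {set U}};
  matroidP : is_matroid matroid_val.1 matroid_val.2 }.

HB.instance Definition _ U := [isSub for @matroid_val U].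
HB.instance Definition _ U := [Equality of matroid U by <:].
HB.instance Definition _ U := [Choice of matroid U by <:].
HB.instance Definition _ U := [Countable of matroid U by <:].
HB.instance Definition _ U := [Finite of matroid U by <:].

Section Matroids.
Variable U : finType.
Implicit Types (M N L P : matroid U) (A B F G : {set U}) (e : U).
Implicit Types (C : {set {set U}}).

Definition ground M : {set U} := (matroid_val M).1.
Definition indep M : {set {set U}} := (matroid_val M).2.

Definition rank M A : nat := \max_(I in indep M | I \subset A) #|I|.
Definition rk M : nat := rank M (ground M).

Definition flats M : {set {set U}} :=
  [set F : {set U} | (F \subset ground M)
     && [forall x in ground M :\: F, rank M F < rank M (x |: F)]].

Lemma indepP M :
  [/\ set0 \in indep M,
      forall A, A \in indep M -> A \subset ground M,
      forall A B, A \in indep M -> B \subset A -> B \in indep M &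
      forall A B, A \in indep M -> B \in indep M -> #|A| < #|B| ->
        exists2 x, x \in B :\: A & x |: A \in indep M].
Proof.
have /and4P[i0 /forall_inP sE /forall_inP sI /forall_inP aug] := matroidP M.
split=> // [A B /sI/forallP/(_ B)/implyP // | A B iA iB ltAB].
by have /forall_inP/(_ B iB)/implyP/(_ ltAB)/exists_inP := aug A iA.
Qed.

Lemma empty_matroid_subproof : is_matroid (set0 : {set U}) [set set0].
Proof.
apply/and4P; split; first by rewrite set11.
- by apply/forall_inP=> A /set1P->.
- by apply/forall_inP=> A /set1P->; apply/forallP=> B; rewrite subset0 in_set1 implybb.
- apply/forall_inP=> A /set1P->; apply/forall_inP=> B /set1P->.
  by rewrite ltnn.
Qed.
Definition empty_matroid : matroid U :=
  @Matroid U (set0, [set set0]) empty_matroid_subproof.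

Definition delete_indep M e : {set {set U}} :=
  [set A in indep M | e \notin A].

Lemma delete_subproof M e : is_matroid (ground M :\ e) (delete_indep M e).
Proof.
have [i0 sE sI aug] := indepP M.
apply/and4P; split; first by rewrite !inE i0.
- by apply/forall_inP=> A; rewrite inE subsetD1 => /andP[/sE-> ->].
- apply/forall_inP=> A; rewrite inE => /andP[iA eA].
  apply/forallP=> B; apply/implyP=> sBA.
  by rewrite inE (sI A) //=; apply: contra eA; apply: (subsetP sBA).
- apply/forall_inP=> A; rewrite inE => /andP[iA eA].
  apply/forall_inP=> B; rewrite inE => /andP[iB eB].
  apply/implyP=> /(aug A B iA iB)[x xBA ixA].
  apply/exists_inP; exists x => //; rewrite !inE ixA (negPf eA) orbF.
  by apply: contraNneq eB => ->; move: xBA; rewrite inE => /andP[].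
Qed.
Definition delete M e : matroid U :=
  @Matroid U (ground M :\ e, delete_indep M e) (delete_subproof M e).

(* Contracting a loop is the same as deleting it. *)
Definition contract_indep M e : {set {set U}} :=
  [set A in indep M | (e \notin A)
     && (([set e] \in indep M) ==> (e |: A \in indep M))].

Lemma contract_subproof M e : is_matroid (ground M :\ e) (contract_indep M e).
Proof.
case ie: ([set e] \in indep M); last first.
  suff ->: contract_indep M e = delete_indep M e by exact: delete_subproof.
  by apply/setP=> A; rewrite !inE ie andbT.
have [i0 sE sI aug] := indepP M.
apply/and4P; split; first by rewrite !inE i0 ie setU0.
- by apply/forall_inP=> A; rewrite inE subsetD1 => /and3P[/sE-> ->].
- apply/forall_inP=> A; rewrite inE ie => /and3P[iA eA ieA].
  apply/forallP=> B; apply/implyP=> sBA.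
  rewrite inE ie (sI _ _ iA sBA) (sI _ _ ieA (setUS _ sBA)) /= andbT.
  by apply: contra eA; apply: (subsetP sBA).
- apply/forall_inP=> A; rewrite inE ie => /and3P[iA eA ieA].
  apply/forall_inP=> B; rewrite inE ie => /and3P[iB eB ieB].
  apply/implyP=> ltAB.
  have [|x] := aug _ _ ieA ieB; first by rewrite !cardsU1 eA eB.
  rewrite !inE negb_or => /andP[/andP[xe xA] /orP[/eqP exe|xB] ixeA].
    by rewrite exe eqxx in xe.
  apply/exists_inP; exists x; first by rewrite inE xA.
  rewrite !inE ie setUCA ixeA (sI _ _ ixeA) ?setUS ?subsetUr //=.
  by rewrite andbT negb_or eq_sym xe.
Qed.
Definition contract M e : matroid U :=
  @Matroid U (ground M :\ e, contract_indep M e) (contract_subproof M e).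

Definition quotient : rel (matroid U) := fun M1 M2 =>
  (ground M1 == ground M2) && (flats M2 \subset flats M1).

Definition nullity_set M1 M2 A : nat := rank M1 A - rank M2 A.
Definition nullity M1 M2 : nat := rk M1 - rk M2.

(* The three definite descriptions below (Higgs lift, one-element extension,
   modular cut of an elementary quotient) are rendered with [pick]; the default
   values are irrelevant, since in each case exactly one object satisfies the
   description in the situations where the notion is used. *)

Definition higgs_lift M1 M2 (i : nat) : matroid U :=
  odflt M1 [pick L | (ground L == ground M1) &&
    (flats L == flats M2 :|: [set F in flats M1 | nullity_set M1 M2 F < i])].

Definition higgs_factorization M1 M2 : seq (matroid U) :=
  [seq higgs_lift M1 M2 (nullity M1 M2 - j) | j <- iota 0 (nullity M1 M2).+1].

Definition flag_matroid (Ms : seq (matroid U)) : bool := sorted quotient Ms.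

(* Consecutive Higgs factorizations share an endpoint, because
   L^0(f_i) = M_(i+1) = L^k(f_(i+1)) with k the nullity of f_(i+1); [behead]
   drops the repeated copy. *)
Definition flag_higgs_factorization (Ms : seq (matroid U)) : seq (matroid U) :=
  if Ms is M1 :: Ms' then
    M1 :: flatten
      (pairmap (fun M M' => behead (higgs_factorization M M')) M1 Ms')
  else [::].

Definition modular_cut M C : bool :=
  [&& C != set0,
      C \subset flats M,
      [forall F in C, forall G in flats M, (F \subset G) ==> (G \in C)] &
      [forall A in C, forall B in C,
         (rank M A + rank M B == rank M (A :&: B) + rank M (A :|: B))
           ==> (A :&: B \in C)]].

Definition extension M C e : matroid U :=
  odflt M [pick P |
    [&& ground P == e |: ground M,
        delete P e == M &
        [set F in flats M | (F \notin flats P) && (e |: F \in flats P)] == C]].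

Definition quotient_cut N N' e : {set {set U}} :=
  odflt set0 [pick C |
    modular_cut N C && (contract (extension N C e) e == N')].

(* P is the extension of N_0 by the elements of D = {e_1, ..., e_(i-1)}
   obtained so far, N is N_(i-1), Ns is N_i, ..., N_k and es is e_i, ..., e_k. *)
Fixpoint major_rec P (D : {set U}) N (Ns : seq (matroid U)) (es : seq U) :
    matroid U :=
  match Ns, es with
  | N' :: Ns', e :: es' =>
      major_rec (extension P [set F :|: D | F in quotient_cut N N' e] e)
        (e |: D) N' Ns' es'
  | _, _ => P
  end.

Definition major (Ns : seq (matroid U)) (es : seq U) : matroid U :=
  if Ns is N0 :: Ns' then major_rec N0 set0 N0 Ns' es else empty_matroid.

Definition higgs_major (Ms : seq (matroid U)) (es : seq U) : matroid U :=
  major (flag_higgs_factorization Ms) es.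

(* The values of phi outside the ground set are irrelevant. *)
Definition realizes (K : fieldType) (V : vectType K) M (phi : U -> V) : Prop :=
  \dim {:V} = rk M /\
  forall A, A \subset ground M ->
    (A \in indep M) = free [seq phi a | a <- enum A].

Definition realizable (K : fieldType) M : Prop :=
  exists (V : vectType K) (phi : U -> V), realizes M phi.

(* Only the spaces and maps with index below [size Ns] matter. *)
Definition chain_realizable (K : fieldType) (Ns : seq (matroid U)) : Prop :=
  exists (V : nat -> vectType K) (phi : forall i, U -> V i)
         (g : forall i, 'Hom(V i, V i.+1)),
    (forall i, i < size Ns -> realizes (nth empty_matroid Ns i) (phi i)) /\
    (forall i, i.+1 < size Ns ->
       {in ground (nth empty_matroid Ns i),
          forall x, phi i.+1 x = g i (phi i x)}).

End Matroids.

Definition infinite_field (K : fieldType) : Prop :=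
  forall s : seq K, exists x : K, x \notin s.

(* Main.v *)
Require Import Defs.
From HB Require Import structures.
From mathcomp Require Import all_boot all_order all_algebra.
From mathcomp Require Import zify.

(** Realize the first matroid of a chain in [V]; a realization of the chain is
    then an increasing sequence of subspaces of [V], the kernels of the maps
    from [V] to the later spaces.  Between two consecutive kernels [W <= W'] of
    a flag, a complete flag in general position with respect to [W] and the
    finitely many spans of subsets of the ground set, which exists over an
    infinite field, realizes the Higgs lifts, whose rank function is
    [A |-> min (rk_1 A, rk_2 A + i)].  For a chain of elementary quotients with
    kernels [W_0 < W_1 < ...], mapping each [e_i] to a generic vector of [W_i]
    realizes the major; conversely, in a realization of the major, the spans of
    [e_1, ..., e_i] are the kernels of a realization of the chain.  The latter
    needs that the extensions in the construction of the major exist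
    (Crapo's theorem). *)

Set Implicit Arguments.
Unset Strict Implicit.
Unset Printing Implicit Defensive.

(** * Rank functions *)

(** Ranks are compared along a chain from [A] up to [B], adding one element at a time; one-element
    estimates thus become global ones. *)
Lemma setU_ind (U : finType) (A B : {set U}) (P : {set U} -> Prop) :
  P A -> (forall x (C : {set U}), A \subset C -> C \subset B -> x \in B -> x
    \notin C ->
            P C -> P (x |: C)) ->
  A \subset B -> P B.
Proof.
move=> PA PS; elim: {B}_.+1 {-2}B (ltnSn #|B|) PS => // n IHn B ltBn PS sAB.
have [->//|] := eqVneq B A; rewrite eqEsubset sAB andbT => /subsetPn[x xB xA].
rewrite -(setD1K xB); apply: (PS) => //; last first.
- apply: IHn; last by rewrite subsetD1 sAB.
  + by move: ltBn; rewrite (cardsD1 x) xB.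
  + move=> y C sAC sCB; rewrite !inE => /andP[yx yB] yC.
    by apply: PS; rewrite // (subset_trans sCB) ?subsetDl.
- by rewrite !inE eqxx.
- by rewrite subsetDl.
- by rewrite subsetD1 sAB.
Qed.

Section Rank.
Variables (U : finType) (M : matroid U).
Implicit Types (A B F G I J : {set U}) (x y e : U).

Lemma rank_leq A : rank M A <= #|A|.
Proof. by apply/bigmax_leqP => I /andP[_ /subset_leq_card]. Qed.

Lemma indep_leq_rank I A : I \in indep M -> I \subset A -> #|I| <= rank M A.
Proof.
move=> iI sIA; rewrite /rank.
by apply: (@leq_bigmax_cond _ _ (fun J : {set U} => #|J|)); rewrite iI.
Qed.

Lemma rank_basis A : exists2 I, I \in indep M & I \subset A /\ #|I| = rank M A.
Proof.
have [i0 _ _ _] := indepP M.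
have P0 : (set0 \in indep M) && (set0 \subset A) by rewrite i0 sub0set.
rewrite /rank (bigmax_eq_arg set0) //; case: arg_maxnP => // I /andP[iI sI] _.
by exists I.
Qed.

Lemma indepE I : (I \in indep M) = (rank M I == #|I|).
Proof.
apply/idP/eqP => [iI|rI].
  by apply/eqP; rewrite eqn_leq rank_leq indep_leq_rank.
have [J iJ [sJI cJ]] := rank_basis I.
by have <- : J = I by apply/eqP; rewrite eqEcard sJI cJ rI /=.
Qed.

Lemma indep_ground I : I \in indep M -> I \subset ground M.
Proof. by have [_ sE _ _] := indepP M; apply: sE. Qed.

Lemma indep_sub I J : J \in indep M -> I \subset J -> I \in indep M.
Proof. by have [_ _ sI _] := indepP M; apply: sI. Qed.

Lemma indep0 : set0 \in indep M.
Proof. by have [] := indepP M. Qed.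

Lemma rankS A B : A \subset B -> rank M A <= rank M B.
Proof.
move=> sAB; have [I iI [sI <-]] := rank_basis A.
by apply: indep_leq_rank => //; apply: subset_trans sAB.
Qed.

Lemma rankIground A : rank M (A :&: ground M) = rank M A.
Proof.
apply/eqP; rewrite eqn_leq rankS ?subsetIl //=.
have [I iI [sI <-]] := rank_basis A.
by apply: indep_leq_rank => //; rewrite subsetI sI indep_ground.
Qed.

Lemma basis_extend J A : J \in indep M -> J \subset A ->
  exists I, [/\ I \in indep M, J \subset I, I \subset A & #|I| = rank M A].
Proof.
move=> iJ sJA; have [B iB [sBA cB]] := rank_basis A.
have [_ _ _ aug] := indepP M.
have [n] := ubnP (rank M A - #|J|); elim: n => // n IHn in J iJ sJA *.
have [ltJB|leBJ] := ltnP #|J| #|B| => ltn; last first.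
  exists J; split=> //; apply/eqP; rewrite eqn_leq indep_leq_rank //=.
  by rewrite -cB.
have [x /setDP[xB xJ] ixJ] := aug _ _ iJ iB ltJB.
have [||I [iI sI sIA cI]] := IHn _ ixJ.
- by rewrite subUset sub1set (subsetP sBA).
- by rewrite cardsU1 xJ; lia.
by exists I; split => //; apply: subset_trans sI; apply: subsetUr.
Qed.

(** Extend a basis [I] of [A :&: B] to a basis [J] of [A], and [J] to a basis [L] of [A :|: B]. Then
    [(L :\: J) :|: I] is an independent subset of [B]. *)
Lemma rank_submod A B :
  rank M (A :|: B) + rank M (A :&: B) <= rank M A + rank M B.
Proof.
have [I iI [sI cI]] := rank_basis (A :&: B).
have sIA : I \subset A by apply: subset_trans sI (subsetIl _ _).
have sIB : I \subset B by apply: subset_trans sI (subsetIr _ _).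
have [J [iJ sIJ sJA cJ]] := basis_extend iI sIA.
have [|L [iL sJL sLAB cL]] := @basis_extend J (A :|: B) iJ.
  by apply: subset_trans sJA (subsetUl _ _).
(* An element of [L :\: J] lying in [A] would enlarge the basis [J] of [A]. *)
have sLJB : L :\: J \subset B.
  apply/subsetP => x /setDP[xL xJ].
  have /setUP[xA|//] := subsetP sLAB _ xL.
  have : #|x |: J| <= rank M A.
    apply: indep_leq_rank; last by rewrite subUset sub1set xA.
    by apply: indep_sub iL _; rewrite subUset sub1set xL.
  by rewrite cardsU1 xJ cJ ltnn.
have : #|(L :\: J) :|: I| <= rank M B.
  apply: indep_leq_rank; last by rewrite subUset sLJB.
  by apply: indep_sub iL _; rewrite subUset subsetDl (subset_trans sIJ).
rewrite cardsU (_ : _ :&: I = set0); last first.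
  apply/setP => x; rewrite !inE.
  by case xI: (x \in I); rewrite ?andbF // (subsetP sIJ _ xI).
rewrite cards0 subn0 cardsD (setIidPr sJL) cL cJ cI.
by have := subset_leq_card sJL; rewrite cL cJ; clear; lia.
Qed.

Lemma rank0 : rank M set0 = 0.
Proof. by apply/eqP; rewrite -leqn0 -(cards0 U) rank_leq. Qed.

Lemma rankU1 x A : rank M (x |: A) <= (rank M A).+1.
Proof.
have := rank_submod [set x] A; have := rank_leq [set x]; rewrite cards1; lia.
Qed.

(** Diminishing returns: submodularity for [x |: A] and [B], in additive form to avoid truncated
    subtraction. *)
Lemma rankU1_mono x A B : A \subset B ->
  rank M (x |: B) + rank M A <= rank M (x |: A) + rank M B.
Proof.
move=> sAB; apply: leq_trans (rank_submod _ _).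
rewrite -setUA (setUidPr sAB) leq_add2l rankS //.
by rewrite subsetI sAB subsetUr.
Qed.

Lemma rankU1S x A B : A \subset B ->
  rank M (x |: A) = rank M A -> rank M (x |: B) = rank M B.
Proof.
move=> /(rankU1_mono x) le_r rA; apply/eqP.
by rewrite eqn_leq (rankS (subsetUr _ _)) andbT; lia.
Qed.

Lemma rankU_eq A B : (forall x, x \in B -> rank M (x |: A) = rank M A) ->
  rank M (A :|: B) = rank M A.
Proof.
move=> rB; apply: (@setU_ind _ A _ (fun C => rank M C = rank M A)) => //;
  last exact: subsetUl.
move=> x C sAC _ /setUP[xA|xB] xC rC.
  by rewrite (subsetP sAC) in xC.
by rewrite (rankU1S sAC) // rB.
Qed.

(** [rank] makes sense on all subsets of [U], and elements outside the ground set behave as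
    loops. *)
Lemma rankU1_out x A : x \notin ground M -> rank M (x |: A) = rank M A.
Proof.
move=> xM; rewrite -rankIground -[RHS]rankIground; congr (rank M _).
apply/setP => y; rewrite !inE; case: eqP => // ->; rewrite (negPf xM).
by rewrite !andbF.
Qed.

Lemma rank_notin x I : x \notin I -> I \in indep M ->
  (x |: I \in indep M) = (rank M (x |: I) != rank M I).
Proof.
move=> xI iI; have := rankU1 x I; have := rankS (subsetUr [set x] I).
by rewrite indepE cardsU1 xI; move: iI; rewrite indepE => /eqP->; lia.
Qed.

Definition mclosure A := [set x in ground M | rank M (x |: A) == rank M A].

Lemma mclosureP x A :
  reflect (x \in ground M /\ rank M (x |: A) = rank M A) (x \in mclosure A).
Proof. by rewrite inE; apply: (iffP andP) => -[? /eqP]. Qed.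

Lemma mclosure_ground A : mclosure A \subset ground M.
Proof. by apply/subsetP => x /mclosureP[]. Qed.

Lemma sub_mclosure A : A :&: ground M \subset mclosure A.
Proof.
apply/subsetP => x /setIP[xA xM]; apply/mclosureP.
split=> //; have /setUidPr -> // : [set x] \subset A by rewrite sub1set.
Qed.

Lemma rankU_mclosure A : rank M (A :|: mclosure A) = rank M A.
Proof. by apply: rankU_eq => x /mclosureP[]. Qed.

Lemma mclosureK A : rank M (mclosure A) = rank M A.
Proof.
apply/eqP; rewrite eqn_leq -{1}(rankU_mclosure A) rankS ?subsetUr //=.
by rewrite -rankIground rankS // sub_mclosure.
Qed.

Lemma flatP F :
  reflect (F \subset ground M /\
     forall x, x \in ground M -> rank M (x |: F) = rank M F -> x \in F)
  (F \in flats M).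
Proof.
rewrite inE; apply: (iffP andP) => -[sF hF]; split=> //.
  move=> x xM rx; apply: contraTT hF => xF.
  by apply/forall_inPn; exists x; rewrite ?inE ?xF // rx ltnn.
apply/forall_inP => x /setDP[xM xF]; rewrite ltn_neqAle rankS ?subsetUr //.
by rewrite andbT; apply: contraNneq xF => /esym/hF->.
Qed.

Lemma mclosure_flat A : mclosure A \in flats M.
Proof.
apply/flatP; split=> [|x xM rx]; first exact: mclosure_ground.
apply/mclosureP; split=> //; apply/eqP.
rewrite eqn_leq (rankS (subsetUr _ _)) andbT.
rewrite -(rankU_mclosure A).
have <- : rank M (x |: (A :|: mclosure A)) = rank M (A :|: mclosure A).
  by apply: rankU1S rx; apply: subsetUr.
by apply: rankS; rewrite setUA subsetUl.
Qed.

Lemma flat_mclosure F : F \in flats M -> mclosure F = F.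
Proof.
move=> /flatP[sF hF]; apply/eqP; rewrite eqEsubset -{3}(setIidPl sF).
by rewrite sub_mclosure andbT; apply/subsetP => x /mclosureP[/hF].
Qed.

Lemma flat_ground F : F \in flats M -> F \subset ground M.
Proof. by case/flatP. Qed.

Lemma mclosureS A B : A \subset B -> mclosure A \subset mclosure B.
Proof.
move=> sAB; apply/subsetP => x /mclosureP[xM rx]; apply/mclosureP; split=> //.
exact: rankU1S rx.
Qed.

Lemma flatI F G : F \in flats M -> G \in flats M -> F :&: G \in flats M.
Proof.
move=> fF fG; have sF := flat_ground fF.
apply/flatP; split=> [|x xM rx]; first by rewrite subIset ?sF.
rewrite -(flat_mclosure fF) -(flat_mclosure fG) inE.
by apply/andP; split; apply/mclosureP; split=> //;
   apply: rankU1S rx; rewrite (subsetIl, subsetIr).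
Qed.

Lemma ground_flat : ground M \in flats M.
Proof. by apply/flatP. Qed.

Lemma mclosure_eq A B : A \subset B -> rank M A = rank M B ->
  mclosure A = mclosure B.
Proof.
move=> sAB rAB; apply/eqP; rewrite eqEsubset mclosureS //=.
apply/subsetP => x /mclosureP[xM rx]; apply/mclosureP; split=> //.
apply/eqP; rewrite eqn_leq (rankS (subsetUr _ _)) andbT rAB -rx.
exact/rankS/setUS.
Qed.

Lemma mclosureIground A : mclosure (A :&: ground M) = mclosure A.
Proof. by apply: mclosure_eq; rewrite ?subsetIl ?rankIground. Qed.

End Rank.

Lemma matroid_eq (U : finType) (M N : matroid U) :
  ground M = ground N -> (forall A : {set U}, A \subset ground M -> rank M A =
    rank N A) ->
  M = N.
Proof.
move=> gMN rMN; apply: val_inj; rewrite /= [LHS]surjective_pairing.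
rewrite [RHS]surjective_pairing; congr (_, _); first exact: gMN.
apply/setP => A; rewrite -/(indep M) -/(indep N).
have [sA|nA] := boolP (A \subset ground M); first by rewrite !indepE rMN.
by rewrite !(contraNF (@indep_ground _ _ A) _) -?gMN.
Qed.

(** * Quotients and Higgs lifts *)

Section Quotients.
Variable U : finType.
Implicit Types (M N L : matroid U) (A B F G I J : {set U}) (x y e : U).

(** Otherwise [A] would span every element of [B], so [B] could not have larger rank. *)
Lemma rank_ltU1 M A B : rank M A < rank M B ->
  exists2 x, x \in B & rank M (x |: A) = (rank M A).+1.
Proof.
move=> ltAB; have [/exists_inP[x xB /eqP rx]|/exists_inPn nB] :=
  boolP [exists x in B, rank M (x |: A) == (rank M A).+1]; first by exists x.
have rB : rank M (A :|: B) = rank M A.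
  apply: rankU_eq => x /nB; have := rankU1 M x A.
  by have := rankS M (subsetUr [set x] A); clear; lia.
by have := rankS M (subsetUr A B); rewrite rB leqNgt ltAB.
Qed.

Lemma quotient_ground M N : quotient M N -> ground M = ground N.
Proof. by case/andP=> /eqP. Qed.

(** The [N]-closure of [A] is a flat of [N], hence of [M], so it contains the [M]-closure. *)
Lemma quotient_mclosure M N A : quotient M N -> mclosure M A \subset mclosure N
  A.
Proof.
move=> qMN; have gMN := quotient_ground qMN; case/andP: qMN => _ /subsetP flMN.
rewrite -(flat_mclosure (flMN _ (mclosure_flat N A))) -(mclosureIground M A).
by rewrite mclosureS // gMN sub_mclosure.
Qed.

(* Monotonicity of the nullity [rank M - rank N], without truncated
   subtraction. *)
Lemma quotient_rank M N A B : quotient M N -> A \subset B ->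
  rank N B + rank M A <= rank M B + rank N A.
Proof.
move=> qMN; have gMN := quotient_ground qMN.
apply: (@setU_ind _ A _
  (fun B => rank N B + rank M A <= rank M B + rank N A)).
  by rewrite addnC.
move=> x C _ _ _ _.
have := rankU1 N x C; have := rankS M (subsetUr [set x] C).
have [xM|xM] := boolP (x \in ground M); last by rewrite !rankU1_out -?gMN.
(* The only critical case is [x] in the [M]-closure of [C]; then [x] is in the [N]-closure as
   well. *)
have [rx|] := eqVneq (rank M (x |: C)) (rank M C); last by clear; lia.
suff /mclosureP[_ ->] : x \in mclosure N C by rewrite rx.
by rewrite (subsetP (quotient_mclosure C qMN)) //; apply/mclosureP.
Qed.

Lemma quotient_rank_leq M N A : quotient M N -> rank N A <= rank M A.
Proof.
by move=> /quotient_rank/(_ (sub0set A)); rewrite !rank0 !addn0.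
Qed.

(** Converse of [quotient_rank]: an element outside a flat of [N] raises its rank in [N], hence in
    [M]. *)
Lemma rank_quotient M N : ground M = ground N ->
  (forall A x, rank N (x |: A) + rank M A <= rank M (x |: A) + rank N A) ->
  quotient M N.
Proof.
move=> gMN rMN; apply/andP; split; first exact/eqP.
apply/subsetP => F /flatP[sF hF]; apply/flatP; rewrite gMN; split=> // x xN rx.
apply: hF => //; have := rMN F x; have := rankS N (subsetUr [set x] F).
by rewrite rx; clear; lia.
Qed.

(** Each matroid is a quotient of the other, so their ranks bound each other. This pins down the
    matroid picked in [higgs_lift]. *)
Lemma flats_inj M N : ground M = ground N -> flats M = flats N -> M = N.
Proof.
move=> gMN flMN.
have qMN : quotient M N by rewrite /quotient gMN flMN eqxx subxx.
have qNM : quotient N M by rewrite /quotient gMN flMN eqxx subxx.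
apply: matroid_eq => // A _; apply/eqP.
by rewrite eqn_leq !quotient_rank_leq.
Qed.

(** * The Higgs lift constructed from its independent sets *)

Section HiggsLift.
Variables (M N : matroid U) (qMN : quotient M N) (i : nat).

(** For a set independent in [M], the bound says that its nullity is at most [i]. *)
Definition higgs_indep := [set A in indep M | #|A| <= rank N A + i].

Lemma higgs_indepS I J : J \in higgs_indep -> I \subset J -> I \in higgs_indep.
Proof.
rewrite !inE => /andP[iJ leJ] sIJ; have iI := indep_sub iJ sIJ.
rewrite iI; move: iJ iI; rewrite !indepE => /eqP rJ /eqP rI.
by have := quotient_rank qMN sIJ; rewrite rJ rI; move: leJ; clear; lia.
Qed.

(** If [#|I|] equals [rank N I + i], an element raising the rank in [N] is needed, and it raises the
    rank in [M] too; otherwise any element raising the rank in [M] will do. As [A] is arbitrary,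
    this serves both the exchange axiom and the rank formula. *)
Lemma higgs_indepU1 I A : I \in higgs_indep ->
  #|I| < rank M A -> #|I| < rank N A + i ->
  exists2 x, x \in A :\: I & x |: I \in higgs_indep.
Proof.
rewrite inE => /andP[iI leI] ltM ltN.
have rI : rank M I = #|I| by apply/eqP; rewrite -indepE.
have [x xA [rMx rNx]] : exists2 x, x \in A &
    rank M (x |: I) = (rank M I).+1 /\ #|I| < rank N (x |: I) + i.
  have [eqI|neI] := eqVneq #|I| (rank N I + i).
    have [|x xA rx] := @rank_ltU1 N I A; first by move: eqI ltN; clear; lia.
    exists x => //; split; last by rewrite eqI rx addSn.
    have := quotient_rank qMN (subsetUr [set x] I); have := rankU1 M x I.
    by rewrite rx; clear; lia.
  have [|x xA rx] := @rank_ltU1 M I A; first by rewrite rI.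
  exists x => //; split=> //; have := rankS N (subsetUr [set x] I).
  by move: leI neI; clear; lia.
have xI : x \notin I.
  apply: contra_eqN rMx => xI; suff -> : x |: I = I by clear; lia.
  by apply/setUidPr; rewrite sub1set.
by exists x; rewrite inE ?xI // indepE cardsU1 xI rMx rI eqxx.
Qed.

Lemma higgs_is_matroid : is_matroid (ground M) higgs_indep.
Proof.
apply/and4P; split; first by rewrite inE indep0 cards0.
- by apply/forall_inP => A; rewrite inE => /andP[/indep_ground].
- apply/forall_inP => A iA; apply/forallP => B; apply/implyP.
  exact: higgs_indepS.
- apply/forall_inP => A iA; apply/forall_inP => B; rewrite inE indepE.
  move=> /andP[/eqP rB leB]; apply/implyP => ltAB; apply/exists_inP.
  apply: higgs_indepU1 => //; first by rewrite rB.
  exact: leq_trans ltAB leB.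
Qed.

Definition higgs_matroid : matroid U :=
  @Matroid U (ground M, higgs_indep) higgs_is_matroid.

Lemma rank_higgs_matroid A :
  rank higgs_matroid A = minn (rank M A) (rank N A + i).
Proof.
have [I iI [sI rI]] := rank_basis higgs_matroid A.
have iI' : I \in higgs_indep by [].
rewrite -rI; apply/eqP; rewrite eqn_leq; apply/andP; split.
  move: iI'; rewrite inE leq_min => /andP[iM leI].
  rewrite indep_leq_rank // (leq_trans leI) // leq_add2r.
  exact: rankS.
rewrite leqNgt leq_min; apply/negP => /andP[ltM ltN].
have [x /setDP[xA xI] ixI] := higgs_indepU1 iI' ltM ltN.
have : #|x |: I| <= rank higgs_matroid A.
  by apply: indep_leq_rank; rewrite // subUset sub1set xA.
by rewrite cardsU1 xI rI ltnn.
Qed.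

(** At [F] and its one-element enlargements the lift has the rank of [M] if the nullity of [F] is
    less than [i], and [rank N + i] otherwise. So the flat condition for [F] is that of [M] or that
    of [N] respectively. *)
Lemma flats_higgs_matroid : flats higgs_matroid =
  flats N :|: [set F in flats M | nullity_set M N F < i].
Proof.
have gMN := quotient_ground qMN.
apply/setP => F; rewrite in_setU [X in _ || X]inE /nullity_set.
have leF := quotient_rank_leq F qMN.
have leFx x := quotient_rank qMN (subsetUr [set x] F).
have [sFM|nF] := boolP (F \subset ground M); last first.
  by rewrite !(contraNF (@flat_ground _ _ F) _) -?gMN.
have [ltF|geF] := ltnP (rank M F - rank N F) i; rewrite ?andbT ?andbF ?orbF.
  have -> : (F \in flats N) || (F \in flats M) = (F \in flats M).
    by apply: orb_idl; case/andP: qMN => _ /subsetP; apply.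
  apply/flatP/flatP => -[_ hF]; split=> // x xM rx; apply: hF => //.
    rewrite !rank_higgs_matroid; move: rx ltF leF (leFx x).
    by have := rankS N (subsetUr [set x] F); clear; lia.
  move: rx; rewrite !rank_higgs_matroid.
  have := rankS N (subsetUr [set x] F); have := rankS M (subsetUr [set x] F).
  by move: ltF leF; clear; lia.
apply/flatP/flatP; rewrite -gMN => -[_ hF]; split=> // x xM rx; apply: hF => //.
  rewrite !rank_higgs_matroid.
  by move: rx geF leF (leFx x); clear; lia.
move: rx; rewrite !rank_higgs_matroid; have := leFx x; move: geF leF.
by have := rankS N (subsetUr [set x] F); clear; lia.
Qed.

Lemma higgs_liftE : higgs_lift M N i = higgs_matroid.
Proof.
rewrite /higgs_lift; case: pickP => [L /andP[/eqP gL /eqP flL]|] /=.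
  by apply: flats_inj; rewrite ?flats_higgs_matroid.
by move=> /(_ higgs_matroid); rewrite flats_higgs_matroid !eqxx.
Qed.

Lemma ground_higgs_lift : ground (higgs_lift M N i) = ground M.
Proof. by rewrite higgs_liftE. Qed.

Lemma rank_higgs_lift A :
  rank (higgs_lift M N i) A = minn (rank M A) (rank N A + i).
Proof. by rewrite higgs_liftE rank_higgs_matroid. Qed.

End HiggsLift.

Definition elementary : rel (matroid U) :=
  fun M N => quotient M N && (rk M == (rk N).+1).

Lemma higgs_lift0 M N : quotient M N -> higgs_lift M N 0 = N.
Proof.
move=> qMN; have gMN := quotient_ground qMN.
apply: matroid_eq => [|A _]; first by rewrite ground_higgs_lift.
by rewrite rank_higgs_lift // addn0; apply/minn_idPr/quotient_rank_leq.
Qed.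

Lemma higgs_lift_nullity M N : quotient M N ->
  higgs_lift M N (nullity M N) = M.
Proof.
move=> qMN; apply: matroid_eq => [|A]; rewrite ground_higgs_lift // => sA.
rewrite rank_higgs_lift //; apply/minn_idPl; rewrite /nullity.
have := quotient_rank qMN sA; have := quotient_rank_leq (ground M) qMN.
by rewrite /rk -(quotient_ground qMN); clear; lia.
Qed.

Lemma higgs_lift_elementary M N i : quotient M N -> i < nullity M N ->
  elementary (higgs_lift M N i.+1) (higgs_lift M N i).
Proof.
move=> qMN lti; apply/andP; split.
  apply: rank_quotient => [|A x];
    rewrite ?ground_higgs_lift // !rank_higgs_lift //.
  have := quotient_rank qMN (subsetUr [set x] A).
  have := rankS N (subsetUr [set x] A); have := rankS M (subsetUr [set x] A).
  clear; lia.
rewrite /rk !ground_higgs_lift // !rank_higgs_lift //.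
move: lti; rewrite /nullity /rk -(quotient_ground qMN).
by clear; lia.
Qed.

Lemma path_iota (T : Type) (e : rel T) (f : nat -> T) m n :
  (forall j, m <= j < m + n -> e (f j) (f j.+1)) ->
  path e (f m) [seq f j | j <- iota m.+1 n].
Proof.
elim: n m => //= n IHn m em; rewrite em; last by lia.
by apply: IHn => j lej; apply: em; lia.
Qed.

Lemma last_iota m n : last m (iota m.+1 n) = m + n.
Proof. by elim: n m => [|n IHn] m /=; rewrite ?addn0 // IHn addSnnS. Qed.

(** Together with the first lift being [M], this makes the tails of consecutive Higgs factorizations
    fit together. *)
Lemma last_higgs_factorization M N : quotient M N ->
  last M (behead (higgs_factorization M N)) = N.
Proof.
move=> qMN; pose f j := higgs_lift M N (nullity M N - j).
have {1}<- : f 0 = M by rewrite /f subn0 higgs_lift_nullity.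
rewrite [behead _]/(map f (iota 1 (nullity M N))) last_map last_iota.
by rewrite /f add0n subnn higgs_lift0.
Qed.

Lemma path_higgs_factorization M N : quotient M N ->
  path elementary M (behead (higgs_factorization M N)).
Proof.
move=> qMN; pose f j := higgs_lift M N (nullity M N - j).
have {1}<- : f 0 = M by rewrite /f subn0 higgs_lift_nullity.
apply: (@path_iota _ _ f 0 (nullity M N)) => j; rewrite add0n => /andP[_ ltj];
  rewrite /f.
have -> : nullity M N - j = (nullity M N - j.+1).+1 by rewrite subnSK.
by apply: higgs_lift_elementary => //; move: ltj; clear; lia.
Qed.

Lemma path_flag_higgs_factorization M Ms : path (@quotient U) M Ms ->
  path elementary M (flatten
    (pairmap (fun M M' => behead (higgs_factorization M M')) M Ms)).
Proof.
elim: Ms M => //= N Ms IHMs M /andP[qMN qMs].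
by rewrite cat_path path_higgs_factorization // last_higgs_factorization ?IHMs.
Qed.

End Quotients.

(** * One-element extensions *)

Section Extensions.
Variable U : finType.
Implicit Types (M N L P : matroid U) (A B F G I J D : {set U}) (x y e : U).
Implicit Types (c : pred {set U}) (C : {set {set U}}).

Lemma rank_delete P e A : e \notin A -> rank (delete P e) A = rank P A.
Proof.
move=> eA; apply/eqP; rewrite eqn_leq; apply/andP; split.
  have [I iI [sI <-]] := rank_basis (delete P e) A.
  by apply: indep_leq_rank => //; move: iI; rewrite inE => /andP[].
have [I iI [sI <-]] := rank_basis P A.
apply: indep_leq_rank => //; rewrite inE iI.
by apply: contra eA; apply: (subsetP sI).
Qed.

(** Stated so as to cover a loop [e] too: then contraction is deletion and [rank P [set e]] is 0. *)
Lemma rank_contract P e A : e \notin A ->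
  rank (contract P e) A + rank P [set e] = rank P (e |: A).
Proof.
move=> eA; have [ie|nie] := boolP ([set e] \in indep P); last first.
  have r0 : rank P [set e] = 0.
    have := rank_leq P [set e]; move: nie; rewrite indepE cards1; clear; lia.
  have -> : contract P e = delete P e.
    apply: val_inj; rewrite /=; congr (_, _).
    by apply/setP => I; rewrite !inE (negPf nie) andbT.
  rewrite r0 addn0 rank_delete //; apply/esym.
  apply: rankU1S (sub0set A) _.
  by rewrite setU0 r0 rank0.
have /eqP -> : rank P [set e] == 1 by rewrite -(cards1 e) -indepE.
apply/eqP; rewrite eqn_leq; apply/andP; split.
  have [I iI [sI <-]] := rank_basis (contract P e) A.
  move: iI; rewrite inE ie => /and3P[iI eI ieI].
  have -> : #|I| + 1 = #|e |: I| by rewrite cardsU1 eI addnC.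
  by apply: indep_leq_rank => //; apply: setUS.
have [|J [iJ sJ sJA <-]] := basis_extend ie (_ : [set e] \subset e |: A).
  exact: subsetUl.
have eJ : e \in J by rewrite -sub1set.
rewrite (cardsD1 e) eJ addnC leq_add2r; apply: indep_leq_rank.
  have iJe : J :\ e \in indep P := indep_sub iJ (subsetDl _ _).
  by rewrite !inE iJe eqxx setD1K // iJ implybT.
by rewrite subDset.
Qed.

(** A modular cut as a predicate on all sets: [c A] stands for the closure of [A] lying in the cut.
    Modularity is only asked for two elements independent over [A], the form that the exchange
    argument uses. *)
Definition cut_pred M c :=
  [/\ forall A B, A \subset B -> rank M A = rank M B -> c B -> c A,
      forall A B, A \subset B -> c A -> c B &
      forall A x y, c (x |: A) -> c (y |: A) ->
        rank M (x |: (y |: A)) = (rank M A).+2 -> c A].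

Lemma cut_predI M c A : cut_pred M c -> c (A :&: ground M) = c A.
Proof.
move=> [c_rk c_up _]; apply/idP/idP; first exact/c_up/subsetIl.
by apply: c_rk; rewrite ?subsetIl ?rankIground.
Qed.

Lemma cut_pred_mclosure M c A : cut_pred M c -> c (mclosure M A) = c A.
Proof.
move=> cutc; have [c_rk c_up _] := cutc; apply/idP/idP.
  rewrite -(cut_predI A cutc); apply: c_rk; first exact: sub_mclosure.
  by rewrite rankIground mclosureK.
by rewrite -(cut_predI A cutc); apply/c_up/sub_mclosure.
Qed.

(** * Crapo's theorem: the one-element extension determined by a cut *)

Section Crapo.
Variables (M : matroid U) (c : pred {set U}) (e : U).
Hypotheses (cutc : cut_pred M c) (eM : e \notin ground M).

(** The new element [e] is to be spanned by exactly the sets in the cut. *)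
Definition ext_indep : {set {set U}} :=
  [set A | (A :\ e \in indep M) && ((e \in A) ==> ~~ c (A :\ e))].

(* The heart of Crapo's theorem: if two independent one-element augmentations
   of [A] both land in the cut, their closures form a modular pair meeting in
   the closure of [A]. *)
Lemma cut_avoid A B : A \in indep M -> B \in indep M -> ~~ c A ->
  #|A| < #|B| -> (#|A|.+1 < #|B|) || ~~ c B ->
  exists2 x, x \in B & (rank M (x |: A) = (rank M A).+1) /\ ~~ c (x |: A).
Proof.
have [c_rk c_up c_mod] := cutc.
rewrite !indepE => /eqP rA /eqP rB ncA ltAB hB.
have [/exists_inP[x xB /andP[/eqP rx ncx]]|/exists_inPn bad] := boolP
  [exists x in B, (rank M (x |: A) == (rank M A).+1) && ~~ c (x |: A)].
  by exists x.
have {}bad x : x \in B -> rank M (x |: A) = (rank M A).+1 -> c (x |: A).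
  by move=> /bad; rewrite negb_and negbK => /orP[/eqP //|].
have [|x xB rx] := @rank_ltU1 _ M A B; first by rewrite rA rB.
have cx := bad _ xB rx.
(* An element of [B] outside the closure of [x |: A] would form with [x] a pair independent over
   [A], putting [A] into the cut. *)
have rxB : rank M ((x |: A) :|: B) = rank M (x |: A).
  apply: rankU_eq => y yB; apply/eqP; apply: contraNT ncA => ry.
  have rxy : rank M (y |: (x |: A)) = (rank M A).+2.
    move: ry; have := rankU1 M y (x |: A).
    by have := rankS M (subsetUr [set y] (x |: A)); rewrite rx; clear; lia.
  apply: (c_mod A y x) => //; apply: bad => //.
  have := rankU1 M x (y |: A); rewrite setUCA rxy.
  by have := rankU1 M y A; clear; lia.
have := rankS M (subsetUr (x |: A) B); rewrite rxB rx rA rB => leB.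
(* So [B] spans [x |: A] and lies in the cut with it, while its size leaves only the second
   alternative of [hB]. *)
have eqB : rank M B = rank M ((x |: A) :|: B).
  by rewrite rxB rx rA rB; apply/eqP; rewrite eqn_leq leB ltAB.
case/orP: hB => [|ncB]; first by rewrite ltnNge leB.
by case/negP: ncB; apply: c_rk eqB _; [apply: subsetUr | apply: c_up cx;
  apply: subsetUl].
Qed.

Lemma ext_is_matroid : is_matroid (e |: ground M) ext_indep.
Proof.
have [c_rk c_up c_mod] := cutc.
have grow A x : x != e -> x |: A :\ e \in indep M ->
    (e \in A -> ~~ c (x |: A :\ e)) -> x |: A \in ext_indep.
  move=> xe ixA ncA; have xE : (x |: A) :\ e = x |: A :\ e.
    by rewrite setDUl; congr (_ :|: _); apply/setDidPl; rewrite disjoints1 inE.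
  by rewrite inE xE ixA !inE eq_sym (negPf xe); apply/implyP.
apply/and4P; split.
- by rewrite inE set0D indep0 inE.
- by apply/forall_inP => A; rewrite inE -subDset => /andP[/indep_ground].
- apply/forall_inP => A; rewrite inE => /andP[iA cA].
  apply/forallP => B; apply/implyP => sBA.
  rewrite inE (indep_sub iA) ?setSD //=; apply/implyP => eB.
  move: cA; rewrite (subsetP sBA) //=; apply: contra.
  by apply: c_up; apply: setSD.
apply/forall_inP => A; rewrite inE => /andP[iA cA].
apply/forall_inP => B; rewrite inE => /andP[iB cB].
apply/implyP => ltAB; apply/exists_inP.
have indepU1 x : rank M (x |: A :\ e) = (rank M (A :\ e)).+1 -> x |: A :\ e \in
  indep M.
  have [xA|xA] := boolP (x \in A :\ e).
    by rewrite (setUidPr _) ?sub1set // => /eqP;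
      rewrite -[X in X == _]addn0 -addn1 eqn_add2l.
  by move=> rx; rewrite rank_notin // rx neq_ltn ltnSn orbT.
have eBNe x : x \in B :\ e -> x != e by case/setD1P.
have xBA x : x \in B :\ e -> rank M (x |: A :\ e) = (rank M (A :\ e)).+1 -> x
  \in B :\: A.
  case/setD1P=> xe xB rx; rewrite inE xB andbT.
  apply: contra_eqN rx => xA; rewrite (setUidPr _);
    last by rewrite sub1set !inE xe.
  by rewrite neq_ltn ltnSn.
(* If [e] is in [A], the exchange takes place between [A :\ e] and [B :\ e] and has to stay outside
   the cut. *)
have [eA|eA] := boolP (e \in A).
  rewrite eA /= in cA.
  have [||x xB [rx ncx]] := cut_avoid iA iB cA.
  - by move: ltAB; rewrite (cardsD1 e A) (cardsD1 e B) eA; case: (e \in B);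
    clear; lia.
  - move: ltAB cB; rewrite (cardsD1 e A) (cardsD1 e B) eA.
    case: (e \in B) => /= [_ ->|ltAB _]; first by rewrite orbT.
    by rewrite [_ < _]ltAB.
  by exists x; rewrite ?xBA //; apply: grow => //;
    [apply: eBNe | apply: indepU1].
have [ltr|ger] := ltnP (rank M (A :\ e)) (rank M (B :\ e)).
  have [x xB rx] := rank_ltU1 ltr; exists x; first exact: xBA.
  by apply: grow; rewrite ?(negPf eA) // ?eBNe ?indepU1.
have [/exists_inP[x xB /eqP rx]|/exists_inPn nx] := boolP
  [exists x in B :\ e, rank M (x |: A :\ e) == (rank M (A :\ e)).+1].
  exists x; first exact: xBA.
  by apply: grow; rewrite ?(negPf eA) // ?eBNe ?indepU1.
(* Now [A] spans [B :\ e], so the sizes force [e] into [B], and [e] itself can be added: if [A] were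
   in the cut, then so would be [B :\ e], which has the same closure. *)
have rAB : rank M (A :\ e :|: B :\ e) = rank M (A :\ e).
  apply: rankU_eq => x /nx; have := rankU1 M x (A :\ e).
  by have := rankS M (subsetUr [set x] (A :\ e)); clear; lia.
move: (iA) (iB) (ger); rewrite !indepE => /eqP-> /eqP->.
move: ltAB; rewrite (cardsD1 e A) (cardsD1 e B) (negPf eA) add0n.
have [eB|_] := boolP (e \in B); last by rewrite add0n ltnNge => /negPf->.
rewrite add1n ltnS => leAB leBA; exists e; first by rewrite inE eA.
rewrite eB /= in cB; rewrite inE setU1K // setU11 /=.
have AE : A :\ e = A.
  by apply/setDidPl; rewrite disjoint_sym disjoints1.
rewrite -{1}AE iA /=; apply: contra cB => cA'.
apply: (c_rk _ (A :\ e :|: B :\ e)); first exact: subsetUr.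
  rewrite rAB; apply/eqP; rewrite eqn_leq ger /=.
  by move: (iA) (iB); rewrite !indepE => /eqP-> /eqP->.
by apply: c_up cA'; rewrite AE subsetUl.
Qed.

Definition ext_matroid : matroid U :=
  @Matroid U (e |: ground M, ext_indep) ext_is_matroid.

Lemma delete_ext_matroid : delete ext_matroid e = M.
Proof.
have eI I : I \in indep M -> I :\ e = I.
  move=> /indep_ground/subsetP sI; apply/setDidPl.
  by rewrite disjoint_sym disjoints1; apply: contra eM; apply: sI.
apply: val_inj; rewrite /= [RHS]surjective_pairing; congr (_, _).
  by rewrite setU1K.
apply/setP => A; rewrite -/(indep M) !inE.
apply/andP/idP => [[/andP[iA _] eA]|iA].
  move: iA; rewrite (setDidPl _) //.
  by rewrite disjoint_sym disjoints1.
rewrite eI // iA; have /negPf -> // : e \notin A.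
by apply: contra eM; apply/subsetP/indep_ground.
Qed.

Lemma rank_ext_matroid A : A \subset ground M ->
  rank ext_matroid (e |: A) = rank M A + ~~ c A.
Proof.
have [c_rk c_up c_mod] := cutc.
move=> sA; have eA : e \notin A by apply: contra eM; apply: subsetP.
have rA : rank ext_matroid A = rank M A.
  by rewrite -[in RHS]delete_ext_matroid rank_delete.
apply/eqP; rewrite eqn_leq; apply/andP; split.
  have [cA|_] := boolP (c A); last by rewrite addn1 -rA rankU1.
  rewrite addn0 leqNgt; apply/negP.
  have [J iJ [sJ <-]] := rank_basis ext_matroid (e |: A).
  move: iJ; rewrite inE => /andP[iJ nc].
  have leJ : #|J :\ e| <= rank M A by apply: indep_leq_rank; rewrite ?subDset.
  rewrite (cardsD1 e); case: (e \in J) nc => /= [nc ltJ|]; last first.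
    by rewrite add0n ltnNge leJ.
  (* Here [J :\ e] is a basis of [A], so it is in the cut with [A], which forbids [e] in [J]. *)
  case/negP: nc; apply: (c_rk _ A) => //; first by rewrite subDset.
  move: iJ; rewrite indepE => /eqP->; apply/eqP.
  by rewrite eqn_leq leJ -ltnS -add1n.
have [cA|ncA] := boolP (c A); first by rewrite addn0 -rA rankS ?subsetUr.
have [I iI [sI <-]] := rank_basis M A.
have eI : e \notin I by apply: contra eA; apply: subsetP.
have -> : #|I| + 1 = #|e |: I| by rewrite cardsU1 eI addnC.
apply: indep_leq_rank; last exact: setUS.
by rewrite inE setU1K // iI setU11 (contra (c_up _ _ sI)).
Qed.

End Crapo.

(** A flat [F] of [delete P e] can fail to be a flat of [P] only because [F] spans [e]. This turns
    the condition in [extension] into one on ranks. *)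
Lemma extension_cutE M P e F : e \notin ground M -> ground P = e |: ground M ->
  delete P e = M -> F \in flats M ->
  ((F \notin flats P) && (e |: F \in flats P)) = (rank P (e |: F) == rank P F).
Proof.
move=> eM gP dP flF; have [sF hF] := flatP _ _ flF.
have eNF B : B \subset ground M -> e \notin B.
  by move=> sB; apply: contra eM; apply: subsetP.
have rP B : B \subset ground M -> rank P B = rank M B.
  by move=> sB; rewrite -dP rank_delete // eNF.
have sxF x : x \in ground M -> x |: F \subset ground M.
  by move=> xM; rewrite subUset sub1set xM.
apply/andP/eqP => [[nF fF]|rF].
  apply/eqP; apply: contraNT nF => rF; apply/flatP; rewrite gP.
  split=> [|x /setU1P[-> /eqP|xM]]; first by rewrite subsetU ?sF ?orbT.
    by rewrite (negPf rF).
  by rewrite !rP ?sxF //; apply: hF.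
split.
  apply: (contra _ (eNF _ sF)) => /flatP[_]; apply=> //.
  by rewrite gP setU11.
apply/flatP; rewrite gP setUS //; split=> // x /setU1P[->|xM rx].
  by rewrite setU11.
rewrite inE (hF x) ?orbT //; apply/eqP;
  rewrite eqn_leq (rankS _ (subsetUr _ _)).
rewrite andbT -rP ?sxF // -[X in _ <= X]rP // -rF -rx rankS //.
by rewrite setUCA subsetUr.
Qed.

(** Any matroid meeting the description in [extension] has these ranks, and [ext_matroid] shows that
    one exists, so the default value of [pick] never occurs. *)
Lemma extensionP M c e (P := extension M [set F in flats M | c F] e) :
  cut_pred M c -> e \notin ground M ->
  [/\ ground P = e |: ground M,
      forall A, e \notin A -> rank P A = rank M A &
      forall A, e \notin A -> rank P (e |: A) = rank M A + ~~ c A].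
Proof.
move=> cutc eM.
have eNF B : B \subset ground M -> e \notin B.
  by move=> sB; apply: contra eM; apply: subsetP.
suff [gP dP cP] : [/\ ground P = e |: ground M, delete P e = M &
    {in flats M, forall F, (rank P (e |: F) == rank P F) = c F}].
  have rP A : e \notin A -> rank P A = rank M A.
    by move=> eA; rewrite -dP rank_delete.
  split=> // A eA; rewrite -rankIground gP -setUIr -(rankIground M A).
  rewrite -(cut_predI _ cutc);
    have: A :&: ground M \subset ground M by apply: subsetIr.
  move: (A :&: _) => {eA}A sA; have eA := eNF _ sA.
  have sAF : A \subset mclosure M A by rewrite -{1}(setIidPl sA) sub_mclosure.
  rewrite -(cut_pred_mclosure A cutc) -cP ?mclosure_flat // -rP //.
  have rF : rank P (mclosure M A) = rank P A.
    by rewrite !rP ?mclosureK // eNF // mclosure_ground.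
  have := rankU1 P e A; have := rankS P (subsetUr [set e] A).
  have := rankS P (setUS [set e] sAF).
  (* [A] and its closure have the same rank, so [e] is spanned by both or by neither. *)
  have [|ne] := eqVneq (rank P (e |: A)) (rank P A).
    by move=> rA; rewrite (rankU1S sAF rA) eqxx rA addn0.
  by case: eqP => [->|_]; move: ne; rewrite ?rF; clear; lia.
rewrite /P /extension;
  case: pickP => [Q /and3P[/eqP gQ /eqP dQ /eqP/setP cQ]|] /=.
  split=> // F flF; rewrite -(extension_cutE eM) //.
  by have := cQ F; rewrite [LHS]inE [RHS]inE flF.
move=> /(_ (ext_matroid e cutc)); rewrite eqxx delete_ext_matroid // eqxx.
case/eqP; apply/setP => F; rewrite [LHS]inE [RHS]inE.
have [flF|//] := boolP (F \in flats M); rewrite /=.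
rewrite (@extension_cutE M) ?delete_ext_matroid //.
have sF := flat_ground flF; rewrite rank_ext_matroid //.
have -> : rank (ext_matroid e cutc) F = rank M F.
  by rewrite -(rank_delete _ (eNF _ sF)) delete_ext_matroid.
by case: (c F); clear; lia.
Qed.

Lemma modular_cut_pred M C : modular_cut M C ->
  cut_pred M (fun A => mclosure M A \in C).
Proof.
case/and4P=> _ /subsetP sC /forall_inP upC /forall_inP modC.
split=> [A B sAB rAB|A B sAB cA|A x y cx cy rxy].
- by rewrite (mclosure_eq sAB rAB).
- have /forall_inP/(_ _ (mclosure_flat M B))/implyP := upC _ cA; apply.
  exact: mclosureS.
have := rankU1 M x A; have := rankU1 M y A.
have := rank_submod M (mclosure M (x |: A)) (mclosure M (y |: A)).
have /forall_inP/(_ _ cy)/implyP := modC _ cx.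
rewrite !mclosureK; set F := mclosure M (x |: A); set G := mclosure M (y |: A).
have sFG : A :&: ground M \subset F :&: G.
  by rewrite subsetI !(subset_trans (sub_mclosure M A)) ?mclosureS ?subsetUr.
have := rankS M sFG; rewrite rankIground.
have : rank M (x |: (y |: A)) <= rank M (F :|: G).
  have -> : x |: (y |: A) = (x |: A) :|: (y |: A) by rewrite setUACA setUid
    setUA.
  by rewrite -rankIground setIUl rankS // setUSS ?sub_mclosure.
rewrite rxy => le1 le2 hC le3 le4 le5.
(* Submodularity leaves no slack: [F] and [G] are a modular pair, and [F :&: G] is the closure of
   [A]. *)
have rFG : rank M A = rank M (F :&: G) by move: le1 le2 le3 le4 le5; clear; lia.
have -> : mclosure M A = F :&: G.
  rewrite -[RHS](@flat_mclosure _ M) ?flatI ?mclosure_flat //.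
  by rewrite -mclosureIground; apply: mclosure_eq; rewrite ?rankIground.
by apply: hC; move: le1 le2 le3 le4 le5; clear; lia.
Qed.

Lemma modular_cutE M C : modular_cut M C ->
  C = [set F in flats M | mclosure M F \in C].
Proof.
case/and4P=> _ /subsetP sC _ _; apply/setP => F; rewrite [RHS]inE.
have [flF|nF] := boolP (F \in flats M); first by rewrite flat_mclosure.
exact: contraNF (sC F) nF.
Qed.

Lemma elementary_nullity M N A : elementary M N -> rank M A <= (rank N A).+1.
Proof.
case/andP=> qMN /eqP rMN; have := quotient_rank qMN (subsetIr A (ground M)).
have -> : rank N (A :&: ground M) = rank N A.
  by rewrite (quotient_ground qMN) rankIground.
rewrite rankIground.
by move: rMN; rewrite /rk -(quotient_ground qMN); clear; lia.
Qed.

(* For [D] the set of elements already added and [N] the contraction of [P] by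
   [D], this is the cut [M_i \cup e_1 \cup ... \cup e_(i-1)] as a predicate on
   all sets instead of flats. *)
Lemma major_cut_pred P D N N' : elementary N N' ->
  (forall A, rank P (A :|: D) = rank N A + #|D|) ->
  cut_pred P (fun A => (rank P (A :|: D) == rank P A) && (rank N' A < rank N
    A)).
Proof.
move=> elN rPD; have [qN _] := andP elN.
split=> [A B sAB rAB|A B sAB|A x y] /=.
- case/andP=> /eqP rB lt'.
  have rA : rank P (A :|: D) = rank P A.
    have := rankS P (subsetUl A D); have := rankS P (setSU D sAB).
    by rewrite rB rAB; clear; lia.
  rewrite rA eqxx /=; move: rA rB lt'; rewrite !rPD rAB.
  by have := rankS N' sAB; clear; lia.
- case/andP=> /eqP rA lt'.
  have rB : rank P (B :|: D) = rank P B.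
    have := rank_submod P B (A :|: D); have := rankS P (subsetUl B D).
    have -> : B :|: (A :|: D) = B :|: D by rewrite setUA (setUidPl sAB).
    have : rank P A <= rank P (B :&: (A :|: D)).
      by rewrite rankS // subsetI sAB subsetUl.
    by rewrite rA; clear; lia.
  by rewrite rB eqxx /=; have := quotient_rank qN sAB; move: lt'; clear; lia.
case/andP=> /eqP rx ltx /andP[/eqP ry lty] rxy.
(* Both [x |: A] and [y |: A] span [D]; submodularity of these sets enlarged by [D] shows that [A]
   does too. *)
have rA : rank P (A :|: D) = rank P A.
  have := rank_submod P (x |: A :|: D) (y |: A :|: D).
  have : rank P (A :|: D) <= rank P ((x |: A :|: D) :&: (y |: A :|: D)).
    by rewrite rankS // subsetI !setSU ?subsetUr.
  have : rank P (x |: (y |: A)) <= rank P ((x |: A :|: D) :|: (y |: A :|: D)).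
    rewrite rankS // subUset sub1set !inE eqxx subsetU //=.
    by apply/orP; right; apply: subsetUl.
  have := rankS P (subsetUl A D); have := rankU1 P x A; have := rankU1 P y A.
  by rewrite rx ry rxy; clear; lia.
rewrite rA eqxx /=.
(* With [n = rank N A], the rank in [N'] is at most [n] on [x |: A] and [y |: A] and at least
   [n + 1] on their union, hence less than [n] on [A]. *)
have := rank_submod N' (x |: A) (y |: A).
have -> : (x |: A) :|: (y |: A) = x |: (y |: A) by rewrite setUACA setUid
  -setUA.
have := rankS N' (_ : A \subset (x |: A) :&: (y |: A)).
rewrite subsetI !subsetUr => /(_ isT).
have := rankS P (subsetUl (x |: (y |: A)) D); rewrite rPD rxy.
have := elementary_nullity (x |: (y |: A)) elN.
have := rankU1 P x A; have := rankU1 P y A.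
by move: rx ry rA ltx lty; rewrite !rPD; clear; lia.
Qed.

Lemma elementary_cut_pred N N' : elementary N N' ->
  cut_pred N (fun A => rank N' A < rank N A).
Proof.
move=> elN; have := @major_cut_pred N set0 N N' elN.
case=> [A|c_rk c_up c_mod]; first by rewrite setU0 cards0 addn0.
split=> [A B sAB rAB|A B sAB|A x y].
- by have := c_rk A B sAB rAB; rewrite !setU0 !eqxx.
- by have := c_up A B sAB; rewrite !setU0 !eqxx.
- by have := c_mod A x y; rewrite !setU0 !eqxx.
Qed.

(** The modular cut of an elementary quotient consists of the flats of nullity one. The proof shows
    both that any cut picked is this one and that this one qualifies. *)
Lemma quotient_cutE N N' e : elementary N N' -> e \notin ground N ->
  quotient_cut N N' e = [set F in flats N | rank N' F < rank N F].
Proof.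
move=> elN eN; have [qN /eqP rkN] := andP elN.
have gN := quotient_ground qN; have cut0 := elementary_cut_pred elN.
have eNF B : B \subset ground N -> e \notin B.
  by move=> sB; apply: contra eN; apply: subsetP.
rewrite /quotient_cut; case: pickP => [C|] /=.
  case/andP=> modC /eqP cN'; have cutC := modular_cut_pred modC.
  rewrite {1}(modular_cutE modC).
  have [gP rP rPe] := extensionP cutC eN;
    rewrite -(modular_cutE modC) in gP rP rPe.
  (* The correction term on the left is the rank of [e] in the extension. *)
  have rN' A : e \notin A ->
      rank N' A + ~~ (mclosure N set0 \in C) =
      rank N A + ~~ (mclosure N A \in C).
    move=> eA; rewrite -{1}cN' -rPe // -rank_contract //; congr (_ + _).
    by rewrite -[[set e]]setU0 rPe ?inE // rank0.
  (* If [e] were a loop, [N] and [N'] would have equal rank. *)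
  have C0 : mclosure N set0 \notin C.
    have [C0|//] := boolP (mclosure N set0 \in C).
    have [_ c_up _] := cutC; have := rN' _ eN.
    rewrite C0 (c_up _ _ (sub0set _) C0) !addn0 => rN.
    by move: rkN; rewrite /rk -gN rN; clear; lia.
  apply/setP => F; rewrite [LHS]inE [RHS]inE.
  have [flF|//] := boolP (F \in flats N); rewrite /=.
  have := rN' F (eNF F (flat_ground flF)); rewrite C0.
  by case: (mclosure N F \in C); clear; lia.
move=> /(_ [set F in flats N | rank N' F < rank N F]) /negP[]; apply/andP;
  split.
  apply/and4P; split.
  - apply/set0Pn; exists (ground N); rewrite inE ground_flat.
    by rewrite -/(rk N) rkN /rk gN ltnSn.
  - by apply/subsetP => F; rewrite inE => /andP[].
  - apply/forall_inP => F; rewrite inE => /andP[_ ltF].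
    apply/forall_inP => G flG; apply/implyP => sFG; rewrite inE flG.
    by case: cut0 => _ + _ => /(_ F G sFG ltF).
  - apply/forall_inP => F; rewrite inE => /andP[flF ltF].
    apply/forall_inP => G; rewrite inE => /andP[flG ltG].
    apply/implyP => /eqP modFG; rewrite inE flatI //=.
    have := rank_submod N' F G; have := elementary_nullity (F :|: G) elN.
    by move: ltF ltG modFG; clear; lia.
have [gP rP rPe] := extensionP cut0 eN.
move: (extension _ _ _) gP rP rPe => Q gQ _ rQe.
have gQe : ground (contract Q e) = ground N by rewrite /ground /= gQ setU1K.
apply/eqP/matroid_eq => [|A]; rewrite gQe // => /eNF eA.
have := rank_contract Q eA.
have -> : rank Q [set e] = 1 by rewrite -[[set e]]setU0 rQe ?inE // !rank0.
rewrite rQe //=.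
have := elementary_nullity A elN; have := quotient_rank_leq A qN.
by clear; lia.
Qed.

End Extensions.

(** * Realizations modulo a subspace *)

Import GRing.Theory.

Section GenericVector.
Local Open Scope ring_scope.
Variables (K : fieldType) (V : vectType K).
Implicit Types (W X : {vspace V}) (v w : V) (Xs : seq {vspace V}).

(** A line with direction [w] meets a subspace not containing [w] in at most one point, so finitely
    many parameters are bad. *)
Lemma line_avoid v w Xs : all (fun X => w \notin X) Xs ->
  exists bad : seq K, forall t : K, t \notin bad ->
    all (fun X => v + t *: w \notin X) Xs.
Proof.
elim: Xs => [_|X Xs IHXs /= /andP[wX /IHXs[bad badP]]]; first by exists [::].
have [s sP] : exists s : seq K, forall t, t \notin s -> v + t *: w \notin X.
  (* This tests whether [v] is in [X + <[w]>]. If not, the line misses [X]; if [v] is [k *: w] plus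
     a vector of [X], only [t = - k] is bad. *)
  have [/eqP vX0|vX] := eqVneq (projv (X + <[w]>) v) v; last first.
    exists [::] => t _; apply: contra vX => vtX.
    rewrite projv_id // -[v](addrK (t *: w)) rpredB //.
      by apply: (subvP (addvSl _ _)).
    by rewrite rpredZ // (subvP (addvSr _ _)) ?memv_line.
  have : v \in (X + <[w]>)%VS by rewrite -(eqP vX0) memv_proj.
  case/memv_addP => x xX [_ /vlineP[k ->] vE].
  exists [:: - k] => t; rewrite inE => tk; apply: contra tk => vtX.
  rewrite -addr_eq0; apply: contraNT wX => tk.
  have : (t + k) *: w \in X.
    have -> : (t + k) *: w = v + t *: w - x.
      by rewrite vE -(addrA x) (addrC x) addrK scalerDl addrC.
    exact: rpredB.
  by move=> /(rpredZ (t + k)^-1); rewrite scalerA mulVf // scale1r.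
exists (s ++ bad) => t; rewrite mem_cat negb_or => /andP[/sP-> /badP->].
by [].
Qed.

(** Over an infinite field [W] is not a finite union of proper subspaces. If the [w] found for [Xs]
    lies in [X], then [v + t *: w] with [v] in [W] outside [X] avoids [X] for all [t], and [Xs] for
    all but finitely many [t]. *)
Lemma avoid_subspaces W Xs : infinite_field K ->
  all (fun X => ~~ (W <= X)%VS) Xs ->
  exists2 w, w \in W & all (fun X => w \notin X) Xs.
Proof.
move=> infK; elim: Xs => [_|X Xs IHXs /= /andP[WX /IHXs[w wW wXs]]].
  by exists 0; rewrite ?mem0v.
have [wX|wX] := boolP (w \in X); last by exists w; rewrite ?wX.
have /subvPn[v vW vX] := WX.
have [bad badP] := line_avoid v wXs; have [t tbad] := infK bad.
exists (v + t *: w); first by rewrite rpredD ?rpredZ.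
rewrite badP // andbT; apply: contra vX => vtX.
by rewrite -[v](addrK (t *: w)) rpredB // rpredZ.
Qed.

Lemma dim_addv1 v W : \dim (<[v]> + W) = (\dim W + (v \notin W))%N.
Proof.
have [vW|vW] := boolP (v \in W); first by rewrite addn0 (addv_idPr _).
rewrite dimv_disjoint_sum ?dim_vline.
  have -> : v != 0 by apply: contraNneq vW => ->; apply: mem0v.
  by rewrite addnC.
apply/eqP; rewrite -subv0; apply/subvP => u; rewrite memv_cap.
case/andP=> /vlineP[k ->] kW; rewrite memv0; apply: contraNT vW.
rewrite scaler_eq0 negb_or => /andP[k0 _].
by have := rpredZ k^-1 kW; rewrite scalerA mulVf // scale1r.
Qed.

End GenericVector.

(** * Spans of subsets and realizations modulo a subspace *)

Section Span.
Variables (U : finType) (K : fieldType) (V : vectType K).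
Implicit Types (phi : U -> V) (A B : {set U}) (x : U) (W X : {vspace V}).

Definition sp phi A : {vspace V} := (\sum_(a in A) <[phi a]>)%VS.

Lemma sp_span phi A : sp phi A = <<[seq phi a | a <- enum A]>>%VS.
Proof. by rewrite span_def big_map big_enum. Qed.

Lemma free_sp phi A :
  free [seq phi a | a <- enum A] = (\dim (sp phi A) == #|A|).
Proof. by rewrite sp_span /free size_map -cardE. Qed.

Lemma sp0 phi : sp phi set0 = 0%VS.
Proof. by rewrite /sp big_set0. Qed.

Lemma sub_spP phi A X :
  reflect (forall a, a \in A -> phi a \in X) (sp phi A <= X)%VS.
Proof. by apply: (iffP subv_sumP) => h a /h; rewrite memvE. Qed.

Lemma mem_sp phi A a : a \in A -> phi a \in sp phi A.
Proof. by move=> aA; apply: (sub_spP phi A _ _). Qed.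

Lemma spS phi A B : A \subset B -> (sp phi A <= sp phi B)%VS.
Proof. by move=> /subsetP sAB; apply/sub_spP => a /sAB/mem_sp. Qed.

Lemma spU phi A B : sp phi (A :|: B) = (sp phi A + sp phi B)%VS.
Proof.
apply: subv_anti; rewrite subv_add !spS ?subsetUl ?subsetUr //= andbT.
apply/sub_spP => a /setUP[] /(mem_sp phi); apply: subvP.
  exact: addvSl.
exact: addvSr.
Qed.

Lemma sp1 phi x : sp phi [set x] = <[phi x]>%VS.
Proof. by rewrite /sp big_set1. Qed.

Lemma eq_sp phi phi' A : {in A, phi =1 phi'} -> sp phi A = sp phi' A.
Proof. by move=> eqphi; apply: eq_bigr => a /eqphi->. Qed.

Lemma dim_spU1 phi x A :
  \dim (sp phi (x |: A)) = \dim (sp phi A) + (phi x \notin sp phi A).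
Proof. by rewrite spU sp1 dim_addv1. Qed.

(* [phi] followed by the projection [V -> V / W] realizes [M]. *)
Definition realizes_mod phi W (M : matroid U) : Prop :=
  \dim {:V} = \dim W + rk M /\
  forall A, A \subset ground M -> \dim (W + sp phi A) = \dim W + rank M A.

(** Passing from independent sets to ranks: the image of a basis of [A] spans [sp phi A], since an
    element with image outside that span would enlarge the basis. *)
Lemma realizes_mod0 M phi : realizes M phi <-> realizes_mod phi 0 M.
Proof.
split=> -[dV hM]; split; rewrite ?dV ?dimv0 // => A sA; last first.
  by rewrite free_sp indepE; have := hM A sA; rewrite add0v dimv0 add0n => ->.
have {}hM B : B \subset A -> (B \in indep M) = (\dim (sp phi B) == #|B|).
  by move=> sB; rewrite -free_sp hM // (subset_trans sB).
rewrite add0v add0n; have [I iI [sI rI]] := rank_basis M A.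
have dI : \dim (sp phi I) = #|I| by apply/eqP; rewrite -hM.
rewrite -rI -dI; congr (\dim _); apply: subv_anti; rewrite (spS phi sI) andbT.
apply/sub_spP => a aA; have [/mem_sp//|aI] := boolP (a \in I).
apply: contraT => naI; have : #|a |: I| <= rank M A.
  apply: indep_leq_rank; last by rewrite subUset sub1set aA.
  rewrite hM; last by rewrite subUset sub1set aA.
  by rewrite dim_spU1 naI dI cardsU1 aI addnC.
by rewrite cardsU1 aI rI ltnn.
Qed.

Lemma dim_addv_lker (V' : vectType K) (f : 'Hom(V, V')) X :
  \dim (lker f + X) = \dim (lker f) + \dim (f @: X).
Proof.
rewrite -(limg_ker_dim f (lker f + X)) limgD (capv_idPr (addvSl _ _)).
have -> : (f @: lker f = 0)%VS by apply/eqP; rewrite -lkerE.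
by rewrite add0v.
Qed.

(* The subspaces [W'] are the kernels of the maps from [V] to the spaces that
   realize [Ns]. *)
Fixpoint realizes_chain phi W (Ns : seq (matroid U)) : Prop :=
  if Ns is N :: Ns' then
    exists W', [/\ (W <= W')%VS, realizes_mod phi W' N &
                   realizes_chain phi W' Ns']
  else True.

(** Indices are shifted by one: [Ws i.+1] belongs to the matroid at position [i], and [Ws 0] to the
    matroid before [Ns]. *)
Lemma realizes_chainP phi W Ns :
  realizes_chain phi W Ns <->
  exists2 Ws : nat -> {vspace V}, Ws 0 = W &
    forall i, i < size Ns -> (Ws i <= Ws i.+1)%VS /\
      realizes_mod phi (Ws i.+1) (nth (empty_matroid U) Ns i).
Proof.
elim: Ns W => [|N Ns IHNs] W /=; first by split=> // _; exists (fun=> W).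
split=> [[W' [sW rW' /IHNs[Ws Ws0 hWs]]]|[Ws Ws0 hWs]].
  exists (fun i => if i is j.+1 then Ws j else W) => // -[|i] /=.
    by rewrite Ws0.
  by rewrite ltnS => /hWs.
exists (Ws 1); have [sW rW] := hWs 0 isT; rewrite -Ws0; split=> //.
by apply/IHNs; exists (fun i => Ws i.+1) => // i lti; apply: (hWs i.+1).
Qed.

End Span.

Lemma limg_sp_comp (U : finType) (K : fieldType) (V V' : vectType K)
    (f : 'Hom(V, V')) (phi : U -> V) (phi' : U -> V') (A : {set U}) :
  {in A, forall a, phi' a = f (phi a)} -> sp phi' A = (f @: sp phi A)%VS.
Proof.
by move=> eqphi; rewrite limg_sum; apply: eq_bigr => a /eqphi->;
  rewrite limg_line.
Qed.

(** * Chains of linear maps as increasing chains of kernels *)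

Section Chain.
Variables (U : finType) (K : fieldType).

Lemma realizes_lker (V V' : vectType K) (f : 'Hom(V, V')) (phi : U -> V)
    (phi' : U -> V') (M : matroid U) :
  {in ground M, forall a, phi' a = f (phi a)} -> limg f = fullv ->
  realizes_mod phi' 0 M <-> realizes_mod phi (lker f) M.
Proof.
move=> eqphi fV; have dV : \dim {:V} = \dim (lker f) + \dim {:V'}.
  by rewrite -fV -dim_addv_lker addvf.
split=> -[dM hM]; split.
- by rewrite dV dM dimv0.
- move=> A sA; rewrite dim_addv_lker -(limg_sp_comp (phi' := phi')).
    by have := hM A sA; rewrite add0v dimv0 add0n => ->.
  by move=> a /(subsetP sA)/eqphi.
- by rewrite dimv0; apply/eqP; rewrite -(eqn_add2l (\dim (lker f))) -dV dM.
move=> A sA; rewrite add0v dimv0 (@limg_sp_comp _ _ _ _ f phi); last first.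
  by move=> a /(subsetP sA)/eqphi.
by have := hM A sA; rewrite dim_addv_lker => /addnI.
Qed.

Section Quotient.
Variables (V : vectType K) (W : {vspace V}).

(** The quotient [V / W] is modelled by the complement [W^C], with the projection along [W] as
    quotient map. *)
Definition quot_map : 'Hom(V, subvs_of W^C) :=
  (linfun (vsproj W^C) \o daddv_pi W^C W)%VF.

Lemma quot_mapK v : vsval (quot_map v) = daddv_pi W^C W v.
Proof. by rewrite comp_lfunE lfunE /= vsprojK ?memv_pi. Qed.

Lemma sub_quot_map v : (v - vsval (quot_map v))%R \in W.
Proof.
have := @daddv_pi_add _ _ W W^C v (capv_compl W).
rewrite addv_complf memvf => /(_ isT) {1}<-.
by rewrite quot_mapK addrK memv_pi.
Qed.

Lemma lker_quot_map : lker quot_map = W.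
Proof.
have capW : (W^C :&: W = 0)%VS by rewrite capvC capv_compl.
apply/vspaceP => v; rewrite memv_ker; apply/eqP/idP => [qv|vW].
  by have := sub_quot_map v; rewrite qv [vsval _]linear0 subr0.
have qW : vsval (quot_map v) \in (W^C :&: W)%VS.
  rewrite memv_cap subvsP /= -[vsval _](subKr v).
  by rewrite rpredB ?sub_quot_map.
by apply: val_inj; apply/eqP; move: qW; rewrite capW memv0.
Qed.

Lemma limg_quot_map : limg quot_map = fullv.
Proof.
have capW : (W^C :&: W = 0)%VS by rewrite capvC capv_compl.
apply/vspaceP => u; rewrite memvf; apply/memv_imgP; exists (vsval u).
  exact: memvf.
by apply: val_inj; rewrite /= quot_mapK daddv_pi_id // subvsP.
Qed.

End Quotient.

Lemma chain_realizableP (E : {set U}) (N : matroid U) (Ns : seq (matroid U)) :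
  {in N :: Ns, forall M, ground M = E} ->
  chain_realizable K (N :: Ns) <->
  exists (V : vectType K) (phi : U -> V),
    realizes_mod phi 0 N /\ realizes_chain phi 0 Ns.
Proof.
move=> gE; pose nthN := nth (empty_matroid U) (N :: Ns).
have gN i : i < size (N :: Ns) -> ground (nthN i) = E.
  by move=> lti; apply/gE/mem_nth.
split=> [[V [phi [g [rphi gphi]]]]|[V [phi [rN /realizes_chainP[Ws Ws0 rWs]]]]].
  (* [f i] is the composite map from [V 0] to [V i]; its kernel will be [Ws i]. *)
  pose f := nat_rect (fun i => 'Hom(V 0, V i)) \1%VF
    (fun i (h : 'Hom(V 0, V i)) => (g i \o h)%VF).
  have phiE i : i < size (N :: Ns) -> {in E, forall a, phi i a = f i (phi 0 a)}.
    elim: i => [|i IHi] lti a aE; first by rewrite id_lfunE.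
    have lti' : i < size (N :: Ns) := ltnW lti.
    rewrite (gphi i lti) -/nthN ?gN // (IHi lti') //.
    by rewrite /f /= comp_lfunE.
  (* [f i] is onto because the vectors [phi i a] span a space of dimension the rank, which is that
     of [V i]. *)
  have fV i : i < size (N :: Ns) -> limg (f i) = fullv.
    move=> lti; apply/eqP; rewrite eqEdim subvf /=.
    have [-> hM] := (realizes_mod0 _ _).1 (rphi i lti).
    rewrite dimv0 add0n; have := hM _ (subxx _).
    rewrite add0v dimv0 add0n -/(rk _) => <-;
      rewrite (limg_sp_comp (f := f i) (phi := phi 0)).
      by apply/dimvS/limgS/subvf.
    by rewrite gN //; apply: phiE.
  have Ws0 : lker (f 0) = 0%VS.
    by apply/eqP; rewrite -subv0; apply/subvP => v;
      rewrite memv_ker id_lfunE memv0.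
  exists (V 0), (phi 0); split; first exact/realizes_mod0/(rphi 0).
  apply/realizes_chainP; exists (fun i => lker (f i)) => // i lti; split.
    apply/subvP => v; rewrite !memv_ker /= comp_lfunE => /eqP->.
    by rewrite linear0.
  rewrite -(realizes_lker (phi' := phi i.+1)) ?fV //.
    exact/realizes_mod0/(rphi i.+1).
  by rewrite (gN i.+1) //; apply: (phiE i.+1).
pose V' i : vectType K := subvs_of (Ws i)^C.
pose g i : 'Hom(V' i, V' i.+1) :=
  (quot_map (Ws i.+1) \o linfun (vsval : subvs_of (Ws i)^C -> V))%VF.
exists V', (fun i a => quot_map (Ws i) (phi a)), g; split=> [i lti|i lti a _].
  apply/realizes_mod0/(realizes_lker (f := quot_map (Ws i)) (phi := phi)) => //.
    exact: limg_quot_map.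
  rewrite lker_quot_map; case: i lti => [|i]; first by rewrite Ws0.
  by case/rWs.
(* The representative of [phi a] modulo [Ws i] differs from [phi a] by a vector of [Ws i], which the
   next quotient map kills. *)
have [sW _] := rWs i lti; have := subvP sW _ (sub_quot_map (Ws i) (phi a)).
rewrite -[in X in _ \in X](lker_quot_map (Ws i.+1)) memv_ker linearB subr_eq0.
by move=> /eqP ->; rewrite /g [RHS]comp_lfunE; congr (quot_map _ _);
  rewrite [RHS]lfunE.
Qed.

End Chain.

(** * Generic refinement and majors *)

Lemma path_elementary_ground (U : finType) (M : matroid U) Ns :
  path (@elementary U) M Ns -> {in M :: Ns, forall N, ground N = ground M}.
Proof.
elim: Ns M => [|N Ns IHNs] M /=; first by move=> _ L; rewrite inE => /eqP->.
case/andP=> /andP[/quotient_ground gM _] /IHNs gNs L.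
by rewrite inE => /predU1P[->//|/gNs ->].
Qed.

(** * Subspaces in general position and Higgs factorizations *)

Section HiggsRefinement.
Variables (U : finType) (K : fieldType) (hK : infinite_field K).
Variables (V : vectType K) (phi : U -> V).
Implicit Types (M N : matroid U) (W X : {vspace V}) (A : {set U}).

Section Step.
Variables (M N : matroid U) (W W' : {vspace V}).
Hypotheses (qMN : quotient M N).
Hypotheses (rM : realizes_mod phi W M) (rN : realizes_mod phi W' N).

(** General position: relative to every span, [X] is as large as [j] vectors of [W'] added to [W]
    can make it. *)
Definition generic_at j X :=
  [/\ (W <= X)%VS, (X <= W')%VS & forall A, A \subset ground M ->
    \dim (X + sp phi A) = minn (\dim (W + sp phi A) + j) (\dim (W' + sp phi
      A))].

Lemma dim_nullity : \dim W' = \dim W + nullity M N.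
Proof.
have [dM _] := rM; have [dN _] := rN; rewrite /nullity.
have := quotient_rank_leq (ground M) qMN; rewrite -/(rk M).
have -> : rank N (ground M) = rk N by rewrite (quotient_ground qMN).
by move: dM dN; clear; lia.
Qed.

Lemma dim_generic j X : generic_at j X -> j <= nullity M N ->
  \dim X = \dim W + j.
Proof.
case=> _ _ /(_ _ (sub0set _)); rewrite sp0 !addv0 => -> lej.
by apply/minn_idPl; rewrite dim_nullity leq_add2l.
Qed.

Lemma generic_step j X : generic_at j X -> j < nullity M N ->
  exists2 X', (X <= X')%VS & generic_at j.+1 X'.
Proof.
move=> genX ltj; have dX := dim_generic genX (ltnW ltj).
have [sWX sXW' hX] := genX.
(* A vector of [W'] outside these finitely many spaces raises the dimension of every [X + sp phi A]
   that is still smaller than [W' + sp phi A]. *)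
pose Xs := [seq (X + sp phi A)%VS |
  A <- enum (powerset (ground M)) & ~~ (W' <= X + sp phi A)%VS].
have [|w wW' wXs] := @avoid_subspaces K V W' Xs hK.
  by apply/allP => Y /mapP[A]; rewrite mem_filter => /andP[? _] ->.
exists (<[w]> + X)%VS; first exact: addvSr.
split=> [||A sA]; first exact: subv_trans (addvSr _ _).
  by rewrite subv_add sXW' andbT -memvE.
have sXA : (X + sp phi A <= W' + sp phi A)%VS by rewrite addvS.
have := hX A sA; have := dimvS sXA; rewrite -addvA dim_addv1.
have [sW'|nW'] := boolP (W' <= X + sp phi A)%VS.
  have -> : (X + sp phi A = W' + sp phi A)%VS.
    by apply: subv_anti; rewrite sXA subv_add sW' addvSr.
  have -> : w \in (W' + sp phi A)%VS by apply: (subvP (addvSl _ _)).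
  by clear; lia.
have -> : w \notin (X + sp phi A)%VS.
  by apply: (allP wXs); apply/mapP; exists A;
    rewrite // mem_filter nW' mem_enum powersetE.
have : \dim (X + sp phi A) != \dim (W' + sp phi A).
  apply: contra nW' => eqd; apply: subv_trans (addvSl W' (sp phi A)) _.
  by have := eqEdim (X + sp phi A) (W' + sp phi A);
    rewrite sXA (eqP eqd) leqnn => /eqP->.
by clear; lia.
Qed.

(** Write [k] for the nullity. Subtracting [\dim W + j] from the minimum in [generic_at] leaves the
    minimum of [rank M A] and [rank N A + (k - j)], the rank in the lift of index [k - j]. *)
Lemma realizes_generic j X : generic_at j X -> j <= nullity M N ->
  realizes_mod phi X (higgs_lift M N (nullity M N - j)).
Proof.
move=> genX lej; have dX := dim_generic genX lej; have dW' := dim_nullity.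
have [_ _ hX] := genX; have [dM hM] := rM; have [dN hN] := rN.
have gMN := quotient_ground qMN.
split=> [|A]; rewrite /rk ground_higgs_lift //; last first.
  move=> sA; have sAN : A \subset ground N by rewrite -gMN.
  rewrite rank_higgs_lift // hX // hM // hN // dX dW'.
  by move: lej; clear; lia.
rewrite rank_higgs_lift // -/(rk M) gMN -/(rk N).
by move: dM dN dX dW' lej; clear; lia.
Qed.

Lemma realizes_chain_iota Ns n j X : generic_at j X -> n + j = nullity M N ->
  realizes_chain phi W' Ns ->
  realizes_chain phi X
    ([seq higgs_lift M N (nullity M N - i) | i <- iota j.+1 n] ++ Ns).
Proof.
elim: n j X => [|n IHn] j X genX eqj rNs /=.
  (* After [nullity M N] steps the generic subspace has the dimension of [W'], so it is [W']. *)
  have -> // : X = W'; apply/eqP; have [_ sX _] := genX.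
  rewrite add0n in eqj; rewrite eqEdim sX dim_nullity.
  by rewrite (dim_generic genX) eqj leqnn.
have [|X' sX genX'] := generic_step genX;
  first by rewrite -eqj addSn ltnS leq_addl.
exists X'; split=> //; last by apply: IHn; rewrite // addnS.
by apply: realizes_generic; rewrite // -eqj addSn ltnS leq_addl.
Qed.

End Step.

(** Forgets the kernels of the intermediate matroids, keeping the one for the last. *)
Lemma realizes_chain_cat W M s Ns : realizes_mod phi W M ->
  realizes_chain phi W (s ++ Ns) ->
  exists W', [/\ (W <= W')%VS, realizes_mod phi W' (last M s) &
                 realizes_chain phi W' Ns].
Proof.
elim: s W M => [|N s IHs] W M rM /=; first by exists W.
case=> X [sWX rN rs]; have [W' [sXW' rl rNs]] := IHs _ _ rN rs.
by exists W'; split=> //; apply: subv_trans sXW'.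
Qed.

Lemma realizes_chain_higgs W M Ms : path (@quotient U) M Ms ->
  realizes_mod phi W M ->
  realizes_chain phi W Ms <-> realizes_chain phi W (flatten
    (pairmap (fun M M' => behead (higgs_factorization M M')) M Ms)).
Proof.
elim: Ms M W => //= N Ms IHMs M W /andP[qMN qMs] rM; split.
  case=> W' [sW rN rMs].
  apply: (@realizes_chain_iota M N W W' qMN rM rN _ (nullity M N) 0).
  - split=> // A sA; rewrite addn0; apply/esym/minn_idPl.
    by apply/dimvS/addvS.
  - exact: addn0.
  exact/(IHMs N W').
case/(realizes_chain_cat rM) => W'; rewrite last_higgs_factorization //.
by case=> sW rN rMs; exists W'; split=> //; apply/(IHMs N W').
Qed.

End HiggsRefinement.

(** * The major of a chain of elementary quotients and its realizations *)

Section Major.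
Variable U : finType.
Implicit Types (M N P : matroid U) (A B D : {set U}) (e : U).

(* [P / D = N], with [D] independent in [P]. *)
Definition contracts_to P D N :=
  [/\ ground P = ground N :|: D, [disjoint ground N & D] &
      forall A, rank P (A :|: D) = rank N A + #|D|].

Lemma rk_contracts_to P D N : contracts_to P D N -> rk P = rk N + #|D|.
Proof. by case=> gP _ rP; rewrite /rk gP rP. Qed.

Lemma rankU_out N A D : [disjoint ground N & D] -> rank N (A :|: D) = rank N A.
Proof.
move=> dND; apply: rankU_eq => x xD; apply: rankU1_out.
by rewrite (disjointFl dND).
Qed.

Section Step.
Variables (P N N' : matroid U) (D : {set U}) (e : U).
Hypotheses (elN : elementary N N') (cP : contracts_to P D N).
Hypothesis (eP : e \notin ground P).
Let c A := (rank P (A :|: D) == rank P A) && (rank N' A < rank N A).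
Let P' := extension P [set F :|: D | F in quotient_cut N N' e] e.

(** A flat of [P] satisfying [c] contains [D], and removing [D] gives a flat of [N] because [N] is
    the contraction of [P] by [D]. *)
Lemma major_cutE :
  [set F :|: D | F in quotient_cut N N' e] = [set F in flats P | c F].
Proof.
have [gP dND rP] := cP; have [qN _] := andP elN.
have dN'D : [disjoint ground N' & D] by rewrite -(quotient_ground qN).
rewrite quotient_cutE //; last by apply: contra eP; rewrite gP inE => ->.
apply/setP => G; rewrite [RHS]inE; apply/imsetP/andP => [[F]|[]].
  rewrite inE => /andP[/flatP[sF hF] ltF] ->; split.
    apply/flatP; rewrite gP setSU //; split=> // x /setUP[xN|xD]; last first.
      by rewrite inE xD orbT.
    by rewrite setUA !rP => /addIn/(hF x xN) xF; rewrite inE xF.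
  by rewrite /c -setUA setUid eqxx !rankU_out.
case/flatP=> sG hG /andP[/eqP rG ltG].
have sDG : D \subset G.
  apply/subsetP => d dD; apply: hG; first by rewrite gP inE dD orbT.
  apply/eqP; rewrite eqn_leq (rankS _ (subsetUr _ _)) andbT -rG rankS //.
  by rewrite setUC setUS ?sub1set.
have GE : G = G :\: D :|: D.
  apply/setP => x; rewrite !inE; have [xD|_] := boolP (x \in D).
    by rewrite (subsetP sDG).
  by rewrite orbF.
exists (G :\: D) => //; rewrite inE; apply/andP; split; last first.
  by move: ltG; rewrite {1 2}GE !rankU_out.
apply/flatP; split=> [|x xN rx]; first by rewrite subDset setUC -gP.
rewrite inE (disjointFr dND) //= hG //; first by rewrite gP inE xN.
by rewrite GE setUA !rP rx.
Qed.

Lemma major_step :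
  [/\ ground P' = e |: ground P,
      forall A, e \notin A -> rank P' A = rank P A &
      forall A, e \notin A -> rank P' (e |: A) = rank P A + ~~ c A].
Proof.
have [_ _ rP] := cP; rewrite /P' major_cutE; apply: extensionP => //.
exact: major_cut_pred.
Qed.

(** [A :|: D] spans [D], so only the nullity of [A], which is 0 or 1, decides whether [e] raises its
    rank. This is the invariant of the recursion. *)
Lemma major_step_contracts_to : contracts_to P' (e |: D) N'.
Proof.
have [gP dND rP] := cP; have [gP' rP' rPe] := major_step.
have [qN _] := andP elN; have gN := quotient_ground qN.
have dN'D : [disjoint ground N' & D] by rewrite -gN.
have [eN eD] : e \notin ground N /\ e \notin D.
  by move: eP; rewrite gP inE => /norP.
split.
- by rewrite gP' gP gN setUCA.
- rewrite disjoint_sym disjoints_subset subUset sub1set inE -gN eN.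
  by rewrite -disjoints_subset disjoint_sym.
(* [e] may be in [A], but it is a loop for [N] and [N'], so it can be removed from [A]. *)
move=> A; have [e0 eA] : e \notin A :\ e /\ e |: A :\ e = e |: A.
  by rewrite setD11; split=> //; apply/setP => x; rewrite !inE; case: eqP.
have rNA L : e \notin ground L -> rank L A = rank L (A :\ e).
  by move=> eL; rewrite -(rankU1_out A eL) -eA rankU1_out.
rewrite rNA -?gN // setUCA setUA -eA -setUA rPe; last first.
  by rewrite inE negb_or e0.
rewrite /c -setUA setUid eqxx (rankU_out _ dN'D) (rankU_out _ dND) cardsU1 eD
  rP.
have := elementary_nullity (A :\ e) elN.
by have := quotient_rank_leq (A :\ e) qN; clear; lia.
Qed.

End Step.

Lemma notin_groundU1 P P' e es : ground P' = e |: ground P -> e \notin es ->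
  {in e :: es, forall x, x \notin ground P} ->
  {in es, forall x, x \notin ground P'}.
Proof.
move=> gP' ees hes x xes; rewrite gP' !inE negb_or hes ?inE ?xes ?orbT // andbT.
by apply: contraNneq ees => <-.
Qed.

(** The total rank is kept because each step lowers the rank of [N] by one and adds one element to
    [D]. *)
Lemma rank_major_rec P D N Ns es : path (@elementary U) N Ns ->
  contracts_to P D N -> uniq es -> {in es, forall e, e \notin ground P} ->
  size es = size Ns ->
  [/\ ground P \subset ground (major_rec P D N Ns es),
      forall A, A \subset ground P -> rank (major_rec P D N Ns es) A = rank P A
        &
      rk (major_rec P D N Ns es) = rk P].
Proof.
elim: Ns es N D P => [|N' Ns IHNs] [|e es] N D P //=.
case/andP=> elN elNs cP /andP[ees ues] hes [sz].
have eP : e \notin ground P by apply: hes; rewrite inE eqxx.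
have [gP' rP' _] := major_step elN cP eP.
have cP' := major_step_contracts_to elN cP eP.
set P' := extension _ _ _ in gP' rP' cP' *.
have hes' := notin_groundU1 gP' ees hes.
have [gQ rQ rkQ] := IHNs es N' (e |: D) P' elNs cP' ues hes' sz.
split=> [|A sA|].
- by apply: subset_trans gQ; rewrite gP' subsetUr.
- rewrite rQ; first by rewrite rP' //; apply: contra eP; apply: subsetP.
  by rewrite gP' subsetU // sA orbT.
rewrite rkQ (rk_contracts_to cP') (rk_contracts_to cP) cardsU1.
have [_ /eqP->] := andP elN; have [gP _ _] := cP.
have -> : e \notin D by apply: contra eP; rewrite gP inE => ->; rewrite orbT.
by rewrite add1n addnS.
Qed.

Variable K : fieldType.

Lemma realizes_contracts_to (V : vectType K) (phi : U -> V) P D N :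
  contracts_to P D N -> realizes_mod phi 0 P -> realizes_mod phi (sp phi D) N.
Proof.
move=> cP; have [gP dND rP] := cP; rewrite /realizes_mod (rk_contracts_to cP).
case=> dV hP.
have hP' A : A \subset ground P -> \dim (sp phi A) = rank P A.
  by move/hP; rewrite add0v dimv0.
have dD : \dim (sp phi D) = #|D|.
  rewrite hP'; last by rewrite gP subsetUr.
  by rewrite -[D]set0U rP rank0 set0U.
split=> [|A sA]; first by rewrite dV dimv0 add0n dD addnC.
by rewrite addvC -spU hP' ?gP ?setSU // rP dD addnC.
Qed.

(** The kernels are the spans of the growing set [D], as dividing by [sp phi D] is the linear form
    of contracting [D]. *)
Lemma realizes_chain_major (V : vectType K) (phi : U -> V) P D N Ns es :
  path (@elementary U) N Ns -> contracts_to P D N -> uniq es ->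
  {in es, forall e, e \notin ground P} -> size es = size Ns ->
  realizes_mod phi 0 (major_rec P D N Ns es) ->
  realizes_chain phi (sp phi D) Ns.
Proof.
elim: Ns es N D P => [|N' Ns IHNs] [|e es] N D P //=.
case/andP=> elN elNs cP /andP[ees ues] hes [sz].
have eP : e \notin ground P by apply: hes; rewrite inE eqxx.
have [gP' rP' _] := major_step elN cP eP.
have cP' := major_step_contracts_to elN cP eP.
set P' := extension _ _ _ in gP' rP' cP' * => rQ.
have hes' := notin_groundU1 gP' ees hes.
exists (sp phi (e |: D)); split.
- exact/spS/subsetUr.
- apply: (realizes_contracts_to cP').
  have [gQ rankQ rkQ] := rank_major_rec elNs cP' ues hes' sz.
  have [dQ hQ] := rQ; split=> [|A sA]; first by rewrite dQ rkQ.
  by rewrite hQ ?rankQ // (subset_trans sA).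
exact: IHNs rQ.
Qed.

Lemma eq_realizes_chain (V : vectType K) (phi phi' : U -> V) E W Ns :
  {in Ns, forall N, ground N = E} -> {in E, phi =1 phi'} ->
  realizes_chain phi W Ns -> realizes_chain phi' W Ns.
Proof.
move=> gNs eqphi; elim: Ns W gNs => //= N Ns IHNs W gNs [W' [sW [dN hN] rNs]].
exists W'; split=> //; last by apply: IHNs => // L LNs; apply: gNs;
  rewrite inE LNs orbT.
split=> // A sA; rewrite -hN //; congr (\dim (_ + _)); apply: eq_sp => a aA.
by rewrite eqphi // -(gNs N) ?inE ?eqxx // (subsetP sA).
Qed.

(** [e] is sent to a generic vector of the next kernel [W'], which lies in [sp phi A] exactly when
    [W'] does, that is, when [A] is in the cut. *)
Lemma major_realizes_chain (hK : infinite_field K) (V : vectType K)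
    (phi : U -> V) P D N Ns es :
  path (@elementary U) N Ns -> contracts_to P D N -> uniq es ->
  {in es, forall e, e \notin ground P} -> size es = size Ns ->
  realizes_mod phi 0 P -> realizes_chain phi (sp phi D) Ns ->
  exists phi' : U -> V, realizes_mod phi' 0 (major_rec P D N Ns es).
Proof.
elim: Ns es N D P phi => [|N' Ns IHNs] [|e es] N D P phi //=;
  first by exists phi.
case/andP=> elN elNs cP /andP[ees ues] hes [sz] rP [W' [sDW' rN' rNs]].
have eP : e \notin ground P by apply: hes; rewrite inE eqxx.
have [gP' rP' rPe] := major_step elN cP eP.
have cP' := major_step_contracts_to elN cP eP.
set P' := extension _ _ _ in gP' rP' rPe cP' *.
have hes' := notin_groundU1 gP' ees hes.
have [gP dND rPD] := cP; have [qN /eqP rkN] := andP elN.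
have gN := quotient_ground qN; have [dP hP0] := rP; have [dN' hN'] := rN'.
have hP A : A \subset ground P -> \dim (sp phi A) = rank P A.
  by move/hP0; rewrite add0v dimv0.
have dW' : \dim W' = #|D|.+1.
  have := rk_contracts_to cP; move: dP dN' rkN; rewrite dimv0.
  by clear; lia.
(* Containment means [rank P A = #|D| + 1 + rank N' A]. In general [rank P A <= rank N A + #|D| <=
   rank N' A + 1 + #|D|], so containment amounts to equality in both places: [A] spans [D], and its
   nullity is one. *)
have sW'E A : A \subset ground P -> (W' <= sp phi A)%VS =
    (rank P (A :|: D) == rank P A) && (rank N' A < rank N A).
  move=> sA; have sWW : (sp phi A <= W' + sp phi A)%VS by apply: addvSr.
  have -> : (W' <= sp phi A)%VS = (\dim (W' + sp phi A) == \dim (sp phi A)).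
    rewrite eq_sym; have [_ ->] := dimv_leqif_sup sWW.
    by rewrite subv_add subvv andbT.
  have -> : \dim (W' + sp phi A) = #|D|.+1 + rank N' A.
    rewrite -dW' -(rankIground N' A) -hN' ?subsetIr // -gN.
    have -> : (W' + sp phi A = W' + sp phi (A :|: D))%VS.
      by rewrite spU (addvC (sp phi A)) addvA (addv_idPl sDW').
    have -> : A :|: D = A :&: ground N :|: D.
      by rewrite setUIl -gP; apply/esym/setIidPl;
        rewrite subUset sA gP subsetUr.
    by rewrite spU (addvC (sp phi (A :&: _))) addvA (addv_idPl sDW').
  have := dimvS sWW; rewrite hP //.
  have := rankS P (subsetUl A D); rewrite rPD.
  have := elementary_nullity A elN; have := quotient_rank_leq A qN.
  by clear; lia.
pose Xs := [seq sp phi A | A <- enum (powerset (ground P)) & ~~ (W' <= sp phi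
  A)%VS].
have [|w wW' wXs] := @avoid_subspaces K V W' Xs hK.
  by apply/allP => Y /mapP[A]; rewrite mem_filter => /andP[? _] ->.
have wE A : A \subset ground P -> (w \notin sp phi A) = ~~ (W' <= sp phi A)%VS.
  move=> sA; apply/idP/idP => [|nW'].
    by apply: contra => sW'; apply: (subvP sW').
  apply: (allP wXs); apply/mapP; exists A;
    first by rewrite mem_filter nW' mem_enum powersetE.
  by [].
pose phi' x := if x == e then w else phi x.
have phiE A : e \notin A -> sp phi' A = sp phi A.
  move=> eA; apply: eq_sp => a aA; rewrite /phi'.
  by case: eqP => // ae; rewrite -ae aA in eA.
have rphi' : realizes_mod phi' 0 P'.
  split=> [|A]; first by rewrite dP (rk_contracts_to cP') (rk_contracts_to cP)
    cardsU1
     (contra _ eP) ?rkN ?add1n ?addnS // gP inE => ->; rewrite orbT.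
  rewrite gP' => sA; rewrite add0v dimv0 add0n.
  have sAe : A :\ e \subset ground P by rewrite subDset.
  have [eA|eA] := boolP (e \in A); last first.
    rewrite phiE // rP' // hP //.
    by move: sAe; rewrite (setDidPl _) // disjoint_sym disjoints1.
  rewrite -(setD1K eA) dim_spU1 phiE ?setD11 // /phi' eqxx wE // sW'E // hP //.
  by rewrite rPe ?setD11.
apply: (IHNs es N' (e |: D) P' phi') => //.
(* [D] together with [e] has image spanning [W'], so the remaining kernels can be kept. *)
suff -> : sp phi' (e |: D) = W'.
  apply: eq_realizes_chain rNs => [L LNs|a aN].
    by apply: (path_elementary_ground elNs); rewrite inE LNs orbT.
  rewrite /phi'; case: eqP => // ae; case/negP: eP.
  by rewrite -ae gP inE gN aN.
apply/eqP; rewrite eqEdim; apply/andP; split.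
  apply/sub_spP => a; rewrite /phi'; case: eqP => // ae /setU1P[//|aD].
  by apply: (subvP sDW'); apply: mem_sp.
have [gP'E _ rP'D] := cP'; have [_ hP'] := rphi'.
have := hP' (e |: D); rewrite add0v dimv0 add0n => ->; last first.
  by rewrite gP'E subsetUr.
rewrite -[e |: D]set0U rP'D rank0 dW' cardsU1.
by rewrite (contra _ eP) // gP inE => ->; rewrite orbT.
Qed.

End Major.

Unset Implicit Arguments.

Theorem corollary3p11 (U : finType) (E : {set U}) (K : fieldType)
    (hK : infinite_field K) (l : nat) (Ms : (l.+1).-tuple (matroid U))
    (hE : {in Ms, forall M, ground M = E}) (hflag : flag_matroid Ms) :
  (chain_realizable K Ms <-> chain_realizable K (flag_higgs_factorization Ms))
  /\
  (forall es : seq U,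
     uniq es -> {in es, forall e, e \notin E} ->
     size (flag_higgs_factorization Ms) = (size es).+1 ->
     (chain_realizable K Ms <-> realizable K (higgs_major Ms es))).
Proof.
case: Ms hE hflag => [[|M Ms] szMs] //= hE qMs.
have gM : ground M = E by apply: hE; rewrite inE eqxx.
have elNs := path_flag_higgs_factorization qMs.
rewrite /higgs_major /=; set Ns := flatten _ in elNs *.
have gNs : {in M :: Ns, forall N, ground N = E}.
  by move=> N /(path_elementary_ground elNs); rewrite gM.
(* In terms of kernels, both chains use the same [V] and [phi]. *)
have flagE : chain_realizable K (M :: Ms) <-> chain_realizable K (M :: Ns).
  rewrite (chain_realizableP _ hE) (chain_realizableP _ gNs).
  split=> -[V [phi [rM rMs]]]; exists V, phi; split=> //.
    exact/(realizes_chain_higgs hK qMs rM).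
  exact/(realizes_chain_higgs hK qMs rM).
split=> // es ues hes [sz]; rewrite flagE (chain_realizableP _ gNs).
(* The recursion starts with no element added and kernel 0. *)
have cM : contracts_to M set0 M.
  split=> [||A]; rewrite ?setU0 ?cards0 ?addn0 //.
  by rewrite disjoint_sym disjoints_subset sub0set.
have hes' : {in es, forall e, e \notin ground M} by rewrite gM.
split=> [[V [phi [rM rNs]]]|[V [phi /realizes_mod0 rQ]]].
  have [|phi' rQ] := major_realizes_chain hK elNs cM ues hes' (esym sz) rM.
    by rewrite sp0.
  by exists V, phi'; apply/realizes_mod0.
exists V, phi; have [gQ rankQ rkQ] := rank_major_rec elNs cM ues hes' (esym sz).
split; last first.
  by have := realizes_chain_major elNs cM ues hes' (esym sz) rQ; rewrite sp0.
(* The major has the rank of [M] and agrees with it on [E], so its realization also realizes [M]. *)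
have [dQ hQ] := rQ; split=> [|A sA]; first by rewrite dQ rkQ.
by rewrite hQ ?rankQ // (subset_trans sA).
Qed.
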